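(* For any $\epsilon>0$ there exists a positive integer $r$ such that, for any positive integer $m$ and any matrix $T\in M_m(\mathbb{C})$ with $\operatorname{diag} T=0$, there exist diagonal orthogonal projections $Q_1,\dots,Q_r\in M_m(\mathbb{C})$, with $\sum_{j=1}^{r}Q_j=I_m$, such that $$\|Q_jTQ_j\|\le \epsilon\|T\|$$ for all $j=1,\dots,r$.
   Context: $M_m(\mathbb{C})$ is the algebra of complex $m\times m$ matrices, $\|\cdot\|$ is the operator norm (with respect to the Euclidean norm on $\mathbb{C}^m$), and $\operatorname{diag}T$ is the diagonal matrix with the same diagonal entries as $T$. A diagonal orthogonal projection is a diagonal matrix all of whose diagonal entries are $0$ or $1$ (the zero matrix is allowed). Note that $r$ depends only on $\epsilon$, not on $m$ or $T$. *)

(* Defs.v *)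
From HB Require Import structures.
From mathcomp Require Import all_boot all_order all_algebra.
From mathcomp Require Import boolp classical_sets reals.
From mathcomp Require Export complex.

Set Implicit Arguments.
Unset Strict Implicit.
Unset Printing Implicit Defensive.

Import Order.TTheory GRing.Theory Num.Theory.

Local Open Scope ring_scope.
Local Open Scope classical_set_scope.
Local Open Scope complex_scope.

(* [normc : R[i] -> R] is the modulus as an element of [R]; the generic
   [`|z|] on [R[i]] is the same number seen in [R[i]]. *)
Definition l2norm (R : realType) (n : nat) (x : 'cV[R[i]]_n) : R :=
  Num.sqrt (\sum_(i < n) ComplexField.Normc.normc (x i 0) ^+ 2).

(* [sup] is only meaningful on nonempty bounded sets; see [opnorm_has_sup]. *)
Definition opnorm (R : realType) (n : nat) (T : 'M[R[i]]_n) : R :=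
  sup [set l2norm (T *m x) | x in [set x : 'cV[R[i]]_n | l2norm x <= 1]].

Definition diag_part (R : realType) (n : nat) (T : 'M[R[i]]_n) : 'M[R[i]]_n :=
  diag_mx (\row_(i < n) T i i).

Definition is_diag_proj (R : realType) (n : nat) (Q : 'M[R[i]]_n) : Prop :=
  is_diag_mx Q /\ forall i : 'I_n, Q i i = 0 \/ Q i i = 1.

Lemma opnorm_has_sup (R : realType) (n : nat) (T : 'M[R[i]]_n) :
  has_sup [set l2norm (T *m x) | x in [set x : 'cV[R[i]]_n | l2norm x <= 1]].
Proof.
pose N := @ComplexField.Normc.normc R.
have NE (z : R[i]) : (N z)%:C = `|z| by case: z.
have N0 z : 0 <= N z by case: z => a b; rewrite /N /= sqrtr_ge0.
have NC (z : R[i]) (a : R) : (`|z| <= a%:C) = (N z <= a) by rewrite -NE lecR.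
split.
  exists (l2norm (T *m 0)), 0 => //=; rewrite /l2norm big1 ?sqrtr0 ?ler01 //.
  by move=> i _; rewrite mxE /= expr0n /= addr0 sqrtr0 expr0n.
exists (Num.sqrt (\sum_i (\sum_j N (T i j)) ^+ 2)) => _ [x /= x1 <-].
rewrite /l2norm ler_wsqrtr // ler_sum // => i _.
have Nx j : N (x j 0) <= 1.
  apply: le_trans x1; rewrite -[leLHS]ger0_norm // -sqrtr_sqr ler_wsqrtr //.
  by rewrite (bigD1 j) //= lerDl sumr_ge0 // => k _; rewrite exprn_ge0.
rewrite lerXn2r ?nnegrE ?sumr_ge0 // -NC mxE.
apply: le_trans (ler_norm_sum _ _ _) _; rewrite rmorph_sum ler_sum //= => j _.
by rewrite normrM -!NE -rmorphM lecR ler_piMr.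
Qed.

(* Main.v *)
(* Let [M = 1/2 + A/4] for a hermitian contraction [A] with zero diagonal, and
   [B = M^-1].  For a colouring [p] of the indices with [r] colours, the
   polynomial [F(z - rho * 1_p)], where [F z = \prod_j \det (B + diag z_j)], is
   positive far enough in the positive orthant exactly when the blocks of [M]
   cut out by [p] have small norm.  As [F] is multi-affine, the average over all
   colourings of these polynomials is obtained from [F] by applying, for each
   index, a first-order operator [1 - t * \sum_j d/dz_j], which preserves real
   stability.  Following Marcus, Spielman and Srivastava, a barrier argument
   (monotonicity and convexity of the logarithmic derivatives) shows that the
   average is positive on a large orthant, and an interlacing argument selects a
   colouring whose own polynomial is positive there.  The block norms of [M] are
   then at most [1/2 + eps/4], so those of [A] are at most [eps] from above;
   the general case follows by applying this to the hermitian parts of [T] and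
   [i T], and to their opposites, and refining the four partitions. *)
Require Import Defs.
From mathcomp Require Import all_boot all_order all_algebra.
From mathcomp Require Import boolp reals polyrcf sesquilinear spectral.
From mathcomp Require Import ring lra.
Set Implicit Arguments.
Unset Strict Implicit.
Unset Printing Implicit Defensive.
Import Order.TTheory GRing.Theory Num.Theory.
Local Open Scope ring_scope.
Local Notation Re := complex.Re.
Local Notation Im := complex.Im.

(** * Multi-affine functions *)

Section MultiAffine.
Variables (K : comNzRingType) (V : finType).
Implicit Types (F : (V -> K) -> K) (z d : V -> K) (u v : V) (w t : K).

Definition upd z v w : V -> K := fun u => if u == v then w else z u.
(** For a function affine in coordinate [v] this difference is the partial derivative. It is purely
    algebraic, so it serves over [R] and [R[i]] alike. *)
Definition pd v F z : K := F (upd z v 1) - F (upd z v 0).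
Definition multiaffine F :=
  forall z v w, F (upd z v w) = F (upd z v 0) + w * pd v F z.
Definition step t (g : {set V}) F z : K := F z - t * \sum_(u in g) pd u F z.

Lemma upd_same z v w w' : upd (upd z v w) v w' = upd z v w'.
Proof. by apply/funext => u; rewrite /upd; case: eqP. Qed.

Lemma updC z u v a b : u != v -> upd (upd z u a) v b = upd (upd z v b) u a.
Proof.
move=> uv; apply/funext => x; rewrite /upd; case: (x =P v) => // ->.
by rewrite eq_sym (negbTE uv).
Qed.

Lemma upd_id z v : upd z v (z v) = z.
Proof. by apply/funext => u; rewrite /upd; case: eqP => [->|]. Qed.

Lemma updE z v w : upd z v w v = w.
Proof. by rewrite /upd eqxx. Qed.

Lemma pd_upd F z v w : pd v F (upd z v w) = pd v F z.
Proof. by rewrite /pd !upd_same. Qed.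

Lemma pd_same F v z : pd v (pd v F) z = 0.
Proof. by rewrite {1}/pd !pd_upd subrr. Qed.

Lemma pdC F u v : pd u (pd v F) = pd v (pd u F).
Proof.
have [->//|uv] := eqVneq u v; apply/funext => z.
by rewrite /pd !(fun a b => @updC z v u a b _) 1?eq_sym//; ring.
Qed.

Lemma multiaffine_upd F z v w :
  multiaffine F -> F (upd z v w) = F z + (w - z v) * pd v F z.
Proof.
move=> maF; rewrite maF -[X in _ = F X + _](upd_id z v) [in RHS]maF; ring.
Qed.

Lemma multiaffine_pd F v : multiaffine F -> multiaffine (pd v F).
Proof.
move=> maF z u w; have [->|uv] := eqVneq u v.
  by rewrite !pd_upd pd_same mulr0 addr0.
rewrite [in LHS]/pd ![upd (upd z u w) v _]updC// maF [X in _ - X]maF /pd.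
by rewrite ![upd (upd z u _) v _]updC//; ring.
Qed.

Lemma pd_step F t g v : pd v (step t g F) = step t g (pd v F).
Proof.
apply/funext => z; rewrite /step.
under [in RHS]eq_bigr do rewrite pdC.
have -> : \sum_(u in g) pd v (pd u F) z =
    \sum_(u in g) pd u F (upd z v 1) - \sum_(u in g) pd u F (upd z v 0).
  by rewrite -sumrB.
by rewrite /pd; ring.
Qed.

Lemma multiaffine_step F t g : multiaffine F -> multiaffine (step t g F).
Proof.
move=> maF z v w; rewrite pd_step /step maF.
under eq_bigr do rewrite (multiaffine_pd _ maF) pdC.
by rewrite big_split/= -mulr_sumr; ring.
Qed.

Lemma stepC F t t' g g' : step t g (step t' g' F) = step t' g' (step t g F).
Proof.
apply/funext => z.
have sumE s (h h' : {set V}) : \sum_(u in h) pd u (step s h' F) z =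
    \sum_(u in h) pd u F z - s * \sum_(u in h) \sum_(v in h') pd v (pd u F) z.
  by under eq_bigr do rewrite pd_step; rewrite /step sumrB mulr_sumr.
have stepE s h G : step s h G z = G z - s * \sum_(u in h) pd u G z by [].
rewrite !stepE !sumE.
have -> : \sum_(u in g) \sum_(v in g') pd v (pd u F) z =
    \sum_(v in g') \sum_(u in g) pd u (pd v F) z.
  rewrite exchange_big/=; apply: eq_bigr => u _; apply: eq_bigr => v _.
  by rewrite pdC.
ring.
Qed.

(** The first-order Taylor expansion of an affine function is exact, so [1 - t * d/dz_v] is a
    translation by [- t]. *)
Lemma step1 F t v z :
  multiaffine F -> step t [set v] F z = F (upd z v (z v - t)).
Proof. by move=> maF; rewrite /step big_set1 multiaffine_upd//; ring. Qed.

(** Reduces questions on [F] along a line to one-variable polynomials; the second identity is the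
    chain rule. *)
Lemma multiaffine_line F z d : multiaffine F ->
  exists p : {poly K}, forall t,
    F (fun v => z v + t * d v) = p.[t] /\
    \sum_v d v * pd v F (fun v => z v + t * d v) = p^`().[t].
Proof.
move=> maF.
(* Induction on a list [s] carrying the support of [d]; [F] varies because the hypothesis is also
   applied to [pd v F]. *)
suff /(_ (enum V) F d (enum_uniq _) maF) [|p Hp] : forall s F d, uniq s ->
    multiaffine F -> (forall v, v \notin s -> d v = 0) ->
    exists p : {poly K}, forall t, F (fun v => z v + t * d v) = p.[t] /\
    \sum_(v <- s) d v * pd v F (fun v => z v + t * d v) = p^`().[t].
- by move=> v; rewrite mem_enum.
- by exists p => t; have [-> <-] := Hp t; rewrite big_enum.
elim=> [|v s IHs] {maF d}F d.
  move=> _ _ d0; exists (F z)%:P => t; rewrite hornerC derivC horner0 big_nil.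
  by split=> //; congr F; apply/funext => v; rewrite d0// mulr0 addr0.
move=> /= /andP[vs us] maF d0.
pose d' := upd d v 0.
have d'0 u : u \notin s -> d' u = 0.
  rewrite /d' /upd => us'; case: eqP => // /eqP uv.
  by rewrite d0// inE negb_or uv.
have zd t : (fun u => z u + t * d u) =
    upd (fun u => z u + t * d' u) v (z v + t * d v).
  by apply/funext => u; rewrite /d' /upd; case: eqP => [->|].
have E G t : multiaffine G -> G (fun u => z u + t * d u) =
    G (fun u => z u + t * d' u) + t * d v * pd v G (fun u => z u + t * d' u).
  by move=> maG; rewrite zd multiaffine_upd// /d' updE; ring.
have [p0 Hp0] := IHs F d' us maF d'0.
have [p1 Hp1] := IHs (pd v F) d' us (multiaffine_pd v maF) d'0.
(* [F] along [d] is [F] along [d'] plus [t * d v] times [pd v F] along [d']. *)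
exists (p0 + (d v)%:P * 'X * p1) => t.
have [e0 e0'] := Hp0 t; have [e1 e1'] := Hp1 t.
split; first by rewrite E// !hornerE e0 e1; ring.
rewrite derivD -mulrA derivM derivC mul0r add0r derivM derivX mul1r !hornerE.
rewrite big_cons -e0' -e1' (E (pd v F))//; last exact: multiaffine_pd.
rewrite pd_same e1 !mulr0 addr0.
rewrite !big_seq mulrDr !mulr_sumr addrCA -big_split/=; congr (_ + _).
apply: eq_bigr => u us'.
have uv : u != v by apply: contraNneq vs => <-.
rewrite (E (pd u F))//; last exact: multiaffine_pd.
have -> : d u = d' u by rewrite /d' /upd (negbTE uv).
by rewrite pdC; ring.
Qed.

End MultiAffine.

(** * Real stability *)

Section ComplexParts.
Variable R : rcfType.
Local Notation C := R[i].
Implicit Types (x y z : C) (t : R).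

Lemma ImM x y : Im (x * y) = Re x * Im y + Im x * Re y.
Proof. by case: x => a b; case: y => c d. Qed.

Lemma ReM x y : Re (x * y) = Re x * Re y - Im x * Im y.
Proof. by case: x => a b; case: y => c d. Qed.

Lemma ImD x y : Im (x + y) = Im x + Im y. Proof. by case: x; case: y. Qed.

Lemma ReD x y : Re (x + y) = Re x + Re y. Proof. by case: x; case: y. Qed.

Lemma ImN x : Im (- x) = - Im x. Proof. by case: x. Qed.

Lemma Im_sum I (r : seq I) (P : pred I) (E : I -> C) :
  Im (\sum_(i <- r | P i) E i) = \sum_(i <- r | P i) Im (E i).
Proof. by apply: big_morph => // -[? ?] []. Qed.

Lemma Re_sum I (r : seq I) (P : pred I) (E : I -> C) :
  Re (\sum_(i <- r | P i) E i) = \sum_(i <- r | P i) Re (E i).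
Proof. by apply: big_morph => // -[? ?] []. Qed.

Lemma sqnormc_gt0 z : z != 0 -> 0 < Re z ^+ 2 + Im z ^+ 2.
Proof.
case: z => a b /=; rewrite eq_complex /= => ab.
by rewrite lt_neqAle eq_sym paddr_eq0 ?sqr_ge0// !sqrf_eq0 ab addr_ge0 ?sqr_ge0.
Qed.

(** Trades the sign of [Im (x / y)] for that of a division-free expression, which passes to limits
    where [y] vanishes. *)
Lemma Im_mul_conj x y : y != 0 ->
  Im (x * conjc y) = Im (x / y) * (Re y ^+ 2 + Im y ^+ 2).
Proof.
move=> /[dup] y0 /sqnormc_gt0; case: x y y0 => a b [c d] _ /= h.
by field; rewrite gt_eqF.
Qed.

Lemma Im_inv x : Im x^-1 = - Im x / (Re x ^+ 2 + Im x ^+ 2).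
Proof. by case: x => a b /=; rewrite mulNr. Qed.

Lemma Im_poly (W : {poly C}) :
  exists w : {poly R}, forall t, Im W.[t%:C%C] = w.[t].
Proof.
exists (\poly_(i < size W) Im W`_i) => t.
rewrite horner_poly horner_coef Im_sum; apply: eq_bigr => i _.
by rewrite -rmorphXn ImM /= mulr0 add0r.
Qed.

Lemma poly_gt0_near0 (p : {poly R}) : 0 < p.[0] ->
  exists2 e, 0 < e & forall t, 0 <= t -> t < e -> 0 < p.[t].
Proof.
move=> p0; have [e e0 pe] := poly_cont 0 p p0; exists e => // t t0 te.
by have := pe t; rewrite subr0 ger0_norm// => /(_ te); rewrite ltr_norml; lra.
Qed.

(** A limit at [0+] taken algebraically: if [Im W.[0]] were positive, [Im W] would be positive just
    to the right of [0], where [Q = 'X^k * Q'] with [Q'.[0] != 0] has no root. *)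
Lemma Im_poly_le0 (W Q : {poly C}) e0 : 0 < e0 -> Q != 0 ->
  (forall t, 0 < t -> t < e0 -> Q.[t%:C%C] != 0 -> Im W.[t%:C%C] <= 0) ->
  Im W.[0] <= 0.
Proof.
move=> e00 Q0 WQ; rewrite leNgt; apply/negP => W0.
have [k [Q' Q'0 QE]] := multiplicity_XsubC Q 0.
rewrite Q0 implyTb in Q'0; rewrite subr0 in QE.
have [w wE] := Im_poly W.
(* The imaginary part of ['i * Q'] is the real part of [Q'], so [re ^+ 2 + im ^+ 2] is the squared
   modulus of [Q'] on the real line. *)
have [re reE] := Im_poly ('i%C%:P * Q').
have [im imE] := Im_poly Q'.
have [e e_gt0 ew] : exists2 e, 0 < e & forall t, 0 <= t -> t < e -> 0 < w.[t].
  by apply: poly_gt0_near0; rewrite -wE.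
have [e1 e1_gt0 ew1] : exists2 e, 0 < e &
    forall t, 0 <= t -> t < e -> 0 < (re ^+ 2 + im ^+ 2).[t].
  apply: poly_gt0_near0; rewrite hornerD !horner_exp -reE -imE hornerM hornerC.
  move: Q'0; rewrite /root => /sqnormc_gt0; case: Q'.[0] => a b /=.
  by rewrite !mul0r !mul1r add0r.
pose t := Num.min e0 (Num.min e e1) / 2.
have m0 : 0 < Num.min e0 (Num.min e e1) by rewrite !lt_min e00 e_gt0.
have t0 : 0 < t by rewrite divr_gt0.
have : t < Num.min e0 (Num.min e e1) by rewrite /t; lra.
rewrite !lt_min => /and3P[te0 te te1].
have := ew t (ltW t0) te; rewrite -wE ltNge WQ//.
rewrite QE hornerM horner_exp hornerX mulf_neq0 ?expf_neq0//; last first.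
  by rewrite eq_complex /= eqxx andbT gt_eqF.
apply/eqP => Q't; have := ew1 t (ltW t0) te1.
rewrite hornerD !horner_exp -reE -imE hornerM hornerC Q't mulr0.
by rewrite /= expr0n addr0 ltxx.
Qed.

End ComplexParts.

(** * Stable multi-affine functions and the operators preserving them *)

Section Stable.
Variables (R : rcfType) (V : finType).
Local Notation C := R[i].
Implicit Types (F : (V -> C) -> C) (z : V -> C) (x : V -> R).

Definition stable F := forall z, (forall v, 0 < Im (z v)) -> F z != 0.
Definition self_conj F := forall z, F (fun v => conjc (z v)) = conjc (F z).
Definition real_stable F := [/\ multiaffine F, stable F & self_conj F].

(** As an affine function of coordinate [v], [F] vanishes at [z v - F z / pd v F z]. Stability keeps
    this zero out of the upper half-plane, which fixes the sign of the imaginary part of the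
    ratio. *)
Lemma stable_ratio F z v : multiaffine F -> stable F ->
  (forall u, 0 < Im (z u)) -> pd v F z = 0 \/ Im (pd v F z / F z) < 0.
Proof.
move=> maF stF z0; have [|p0] := eqVneq (pd v F z) 0; [by left|right].
have Fz := stF _ z0.
set q := pd v F z / F z; have q0 : q != 0 by rewrite mulf_neq0// invr_neq0.
pose w := - q^-1.
have Fw : F (upd z v (z v + w)) = 0.
  by rewrite multiaffine_upd// /w /q; field; rewrite Fz p0.
have : ~~ (0 < Im (z v + w)).
  apply/negP => zw; have /stF : forall u, 0 < Im (upd z v (z v + w) u).
    by move=> u; rewrite /upd; case: eqP => // ->.
  by rewrite Fw eqxx.
rewrite -leNgt ImD /w ImN Im_inv mulNr opprK.
move=> h; have := z0 v; have : Im q / (Re q ^+ 2 + Im q ^+ 2) < 0.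
  by have := z0 v; lra.
by rewrite pmulr_llt0// invr_gt0 sqnormc_gt0.
Qed.

(** With [F z] factored out, a zero means that [t] times the sum of the ratios is 1. Unless [t = 0],
    the imaginary parts, all of one sign, then vanish; by [stable_ratio] so do the ratios, and 0 =
    1. *)
Lemma stable_step F (g : {set V}) (t : R) : 0 <= t ->
  multiaffine F -> stable F -> stable (step t%:C%C g F).
Proof.
move=> t0 maF stF z z0; have Fz := stF z z0.
have ratio v := stable_ratio v maF stF z0.
have Im_le0 v : Im (pd v F z / F z) <= 0.
  by case: (ratio v) => [->|/ltW//]; rewrite mul0r.
have -> : step t%:C%C g F z =
    F z * (1 - t%:C%C * \sum_(u in g) (pd u F z / F z)).
  by rewrite /step -mulr_suml; field.
rewrite mulf_neq0// subr_eq0; apply/eqP => h.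
have S0 : Im (t%:C%C * \sum_(u in g) (pd u F z / F z)) = 0 by rewrite -h.
have {}S0 : t * \sum_(u in g) - Im (pd u F z / F z) = 0.
  by move: S0; rewrite ImM /= mul0r addr0 Im_sum sumrN mulrN => ->; rewrite oppr0.
move/eqP: S0; rewrite mulf_eq0 => /orP[/eqP t00|].
  by move: h; rewrite t00 mul0r => /eqP; rewrite oner_eq0.
rewrite psumr_eq0; last by move=> u _; rewrite oppr_ge0.
move=> /allP all0; move: h; rewrite big1 ?mulr0; last first.
  move=> u ug; case: (ratio u) => [->|]; first by rewrite mul0r.
  have /implyP/(_ ug) := all0 u (mem_index_enum _).
  by rewrite oppr_eq0 => /eqP ->; rewrite ltxx.
by move=> /eqP; rewrite oner_eq0.
Qed.

Lemma self_conj_pd F v : self_conj F -> self_conj (pd v F).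
Proof.
move=> cF z; rewrite /pd rmorphB/= -!cF; congr (F _ - F _); apply/funext => u.
  by rewrite /upd; case: eqP => // _; rewrite rmorph1.
by rewrite /upd; case: eqP => // _; rewrite rmorph0.
Qed.

Lemma self_conj_step F (t : R) g : self_conj F -> self_conj (step t%:C%C g F).
Proof.
move=> cF z; rewrite /step; under eq_bigr do rewrite self_conj_pd//.
rewrite cF -(rmorph_sum conjc) -[t%:C%C in LHS](conjc_real t).
by rewrite -(rmorphM conjc) -(rmorphB conjc).
Qed.

Lemma real_stable_step F (t : R) g : 0 <= t ->
  real_stable F -> real_stable (step t%:C%C g F).
Proof.
move=> t0 [maF stF cF]; split; first exact: multiaffine_step.
  exact: stable_step.
exact: self_conj_step.
Qed.

(** Extends the sign of the ratio to the closed half-plane: all coordinates are raised by [i t], and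
    [t] tends to 0. *)
Lemma stable_weak F z v : real_stable F -> (forall u, 0 <= Im (z u)) ->
  Im (pd v F z * conjc (F z)) <= 0.
Proof.
move=> [maF stF cF] z0.
have [p pE] := multiaffine_line z (fun=> 'i%C) maF.
have [q qE] := multiaffine_line z (fun=> 'i%C) (multiaffine_pd v maF).
have z_line : (fun u => z u + 0 * 'i%C) = z.
  by apply/funext => u; rewrite mul0r addr0.
(* At real [t] conjugating the value amounts to conjugating the coefficients, so the product stays
   polynomial in [t]. *)
have conjp (t : R) : (map_poly conjc p).[t%:C%C] = conjc p.[t%:C%C].
  by rewrite -[in LHS](conjc_real t) horner_map.
have [q0 _] := qE 0; have [p0 _] := pE 0; rewrite z_line in q0 p0.
rewrite q0 p0.
have : Im (q * map_poly conjc p).[0] <= 0.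
  apply: (@Im_poly_le0 _ _ 1 1) => // [|t t0 _ _]; rewrite ?oner_neq0//.
  rewrite hornerM conjp; have [<- _] := qE t%:C%C; have [<- _] := pE t%:C%C.
  have h u : 0 < Im (z u + t%:C%C * 'i%C).
    by have := z0 u; case: (z u) => a b /=; lra.
  rewrite Im_mul_conj ?stF// mulr_le0_ge0 ?addr_ge0 ?sqr_ge0//.
  by case: (stable_ratio v maF stF h) => [->|/ltW//]; rewrite mul0r.
by have := conjp 0; rewrite rmorph0 hornerM => ->.
Qed.

End Stable.

(** * Positivity on orthants and interlacing *)

Section Orthant.
Variables (R : realFieldType) (V : finType).
Implicit Types (f : (V -> R) -> R) (b x y : V -> R) (g : {set V}).

(** In barrier terminology, [b] lies above the zeros of [f]. *)
Definition above b f := forall x, (forall v, b v <= x v) -> 0 < f x.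
(** The strongly Rayleigh inequalities: where [f] is positive, they say that [pd v f / f] does not
    increase in coordinate [u]. *)
Definition rayleigh f :=
  forall x u v, f x * pd u (pd v f) x <= pd u f x * pd v f x.

Lemma above_le b b' f : (forall v, b v <= b' v) -> above b f -> above b' f.
Proof. by move=> bb' bf x b'x; apply: bf => v; apply: le_trans (b'x v). Qed.

Lemma le_upd b y v w : (forall u, b u <= y u) -> b v <= w ->
  forall u, b u <= upd y v w u.
Proof. by move=> by_ bw u; rewrite /upd; case: eqP => [->|]. Qed.

(** The coordinates are raised one at a time; for one coordinate, cross-multiplication leaves the
    increment times a Rayleigh inequality. *)
Lemma rayleigh_decr f b y y' v : multiaffine f -> rayleigh f -> above b f ->
  (forall u, b u <= y u) -> (forall u, y u <= y' u) ->
  pd v f y' / f y' <= pd v f y / f y.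
Proof.
move=> maf rf bf by_ yy'.
pose mix (s : seq V) u := if u \in s then y' u else y u.
have ymix s u : y u <= mix s u by rewrite /mix; case: ifP.
suff mixP s : pd v f (mix s) / f (mix s) <= pd v f y / f y.
  have := mixP (enum V); rewrite (_ : mix _ = y')//.
  by apply/funext => u; rewrite /mix mem_enum.
elim: s => [|u s IHs].
  by rewrite (_ : mix [::] = y).
apply: le_trans IHs.
have -> : mix (u :: s) = upd (mix s) u (y' u).
  apply/funext => w; rewrite /mix /upd inE.
  by case: (w =P u) => [->|].
have bmix w : b w <= mix s w by apply: le_trans (ymix s w).
have f0 := bf _ bmix.
have yu : mix s u <= y' u by rewrite /mix; case: ifP.
have f1 : 0 < f (upd (mix s) u (y' u)).
  by apply: bf; apply: le_upd => //; apply: le_trans yu.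
rewrite ler_pdivrMr// mulrAC ler_pdivlMr//.
rewrite (multiaffine_upd _ _ _ maf) (multiaffine_upd _ _ _ (multiaffine_pd v maf)).
have := rf (mix s) u v; move: (mix s) yu => z; rewrite -subr_ge0.
set w := y' u - z u => w0 h.
have := ler_wpM2l w0 h; lra.
Qed.

Lemma ge0_slope (a c : R) : (forall s, 0 <= s -> 0 <= a + s * c) -> 0 <= c.
Proof.
move=> h; rewrite leNgt; apply/negP => c0.
have s0 : 0 <= (1 + `|a|) / - c by rewrite divr_ge0 ?addr_ge0// oppr_ge0 ltW.
have := h _ s0; rewrite (_ : _ * c = - (1 + `|a|)); last first.
  by field; rewrite lt_eqF.
by have := ler_norm a; lra.
Qed.

(** If [f y0 < 0], some [pd u f y0] with [u] in [g] is negative. But [step t g f] is nonnegative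
    along rays in direction [u], so its slope is nonnegative, and induction on [g] applied to
    [pd u f] contradicts this. *)
Lemma step_ge0 f b t g : 0 < t -> multiaffine f ->
  (forall y, (forall v, b v <= y v) -> 0 <= step t g f y) ->
  forall y, (forall v, b v <= y v) -> 0 <= f y.
Proof.
move=> t0; have [n] := ubnP #|g|; elim: n => // n IHn in f g *.
rewrite ltnS => gn maf hstep y0 by0; rewrite leNgt; apply/negP => fy0.
have /exists_inP[u ug pdu] : [exists u in g, pd u f y0 < 0].
  rewrite -[X in is_true X]negbK; apply/negP => /exists_inPn all_ge0.
  have := hstep _ by0; rewrite /step leNgt => /negP; apply.
  rewrite subr_lt0; apply: lt_le_trans fy0 _; rewrite pmulr_rge0//.
  by apply: sumr_ge0 => u ug; rewrite leNgt all_ge0.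
have gu : (#|g :\ u| < n)%N by move: gn; rewrite (cardsD1 u g) ug.
have := IHn (pd u f) (g :\ u) gu (multiaffine_pd u maf) _ y0 by0.
rewrite leNgt pdu => /(_ _)/wrap[]//.
move=> y by_.
(* Dropping [u] from [g] costs nothing since [pd u (pd u f) = 0]. *)
have -> : step t (g :\ u) (pd u f) y = pd u (step t g f) y.
  by rewrite pd_step /step [in RHS](big_setD1 u)//= pd_same add0r.
apply: (@ge0_slope (step t g f y)) => s s0.
have := hstep (upd y u (y u + s)).
rewrite multiaffine_upd ?(addrC (y u)) ?addrK; last exact: multiaffine_step.
by apply; apply: le_upd => //; have := by_ u; lra.
Qed.

(** Only strictness remains: at a zero of [f] the derivatives would have a negative sum, yet each is
    nonnegative because [f] is nonnegative further along the orthant. *)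
Lemma above_step f b t g : 0 < t -> multiaffine f ->
  above b (step t g f) -> above b f.
Proof.
move=> t0 maf bs; have f_ge0 : forall y, (forall v, b v <= y v) -> 0 <= f y.
  by apply: (step_ge0 t0 maf (g := g)) => y by_; apply/ltW/bs.
move=> y by_; rewrite lt_neqAle f_ge0// andbT eq_sym; apply/eqP => fy.
have := bs y by_; rewrite /step fy sub0r oppr_gt0 pmulr_rlt0//.
apply/negP; rewrite -leNgt sumr_ge0// => u ug.
apply: (@ge0_slope (f y)) => s s0.
have := f_ge0 (upd y u (y u + s)).
rewrite multiaffine_upd// ?(addrC (y u)) ?addrK; apply.
by apply: le_upd => //; have := by_ u; lra.
Qed.

(* [step (rho / #|g|) g f] is the average of the [step rho [set v] f]; since
   each ratio [pd v f / f] is decreasing, the sign of [step rho [set v] f] on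
   the whole orthant is decided at its corner [b]. *)
Lemma above_choice f b rho g : 0 < rho -> (0 < #|g|)%N ->
  multiaffine f -> rayleigh f -> above b (step (rho / #|g|%:R) g f) ->
  exists2 v, v \in g & above b (step rho [set v] f).
Proof.
move=> rho0 g0 maf rf bs.
have n0 : 0 < #|g|%:R :> R by rewrite ltr0n.
have bf : above b f by apply: above_step bs; rewrite ?divr_gt0.
have bb v : b v <= b v by [].
have : 0 < \sum_(v in g) (f b - rho * pd v f b).
  rewrite sumrB sumr_const -mulr_sumr.
  have := mulr_gt0 n0 (bs b bb); rewrite /step -mulr_natl.
  set S := \sum_(_ in _) _; congr (0 < _).
  by field; rewrite gt_eqF.
move=> sum_gt0.
have /exists_inP[v vg pv] : [exists v in g, 0 < f b - rho * pd v f b].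
  rewrite -[X in is_true X]negbK; apply/negP => /exists_inPn all_le0.
  move: sum_gt0; rewrite ltNge => /negP; apply.
  by apply: sumr_le0 => v vg; rewrite leNgt all_le0.
exists v => // y by_; rewrite /step big_set1 subr_gt0.
have fy := bf y by_; have fb := bf b bb.
have := rayleigh_decr v maf rf bf bb by_.
rewrite ler_pdivrMr// => h.
apply: (@le_lt_trans _ _ (rho * (pd v f b / f b * f y))).
  by rewrite ler_pM2l.
rewrite mulrA gtr_pMl// mulrA ltr_pdivrMr// mul1r; lra.
Qed.

End Orthant.

(** * Restriction of real stable functions to real points *)

Section Restriction.
Variables (R : rcfType) (V : finType).
Local Notation C := R[i].
Implicit Types (F : (V -> C) -> C) (x : V -> R).

Definition restr F x : R := Re (F (fun v => (x v)%:C%C)).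

Lemma upd_real x v (w : R) :
  (fun u => (upd x v w u)%:C%C) = upd (fun u => (x u)%:C%C) v w%:C%C.
Proof. by apply/funext => u; rewrite /upd; case: eqP. Qed.

Lemma restrE F x : self_conj F -> F (fun v => (x v)%:C%C) = (restr F x)%:C%C.
Proof.
move=> cF; have := cF (fun v => (x v)%:C%C); rewrite /restr.
rewrite (_ : (fun v => conjc _) = fun v => (x v)%:C%C); last first.
  by apply/funext => v; rewrite conjc_real.
by case: (F _) => a b [] => ?; congr (_ +i* _)%C; lra.
Qed.

Lemma restr_pd F v : restr (pd v F) = pd v (restr F).
Proof.
apply/funext => x; rewrite /restr /pd !upd_real rmorph1 rmorph0.
by case: (F _) => a b; case: (F _).
Qed.

Lemma restr_step F (t : R) g : restr (step t%:C%C g F) = step t g (restr F).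
Proof.
apply/funext => x; rewrite {1}/restr /step.
under [in RHS]eq_bigr do rewrite -restr_pd.
rewrite -Re_sum /restr; case: (F _) => a b; case: (\sum_(u in g) _) => c d /=.
by rewrite mul0r subr0.
Qed.

Lemma multiaffine_restr F : multiaffine F -> multiaffine (restr F).
Proof.
move=> maF x v w; rewrite -restr_pd /restr !upd_real maF rmorph0.
by rewrite ReD ReM /= mul0r subr0.
Qed.

(** Adding [i] to coordinate [u] of a real point turns [F] into [F + i * pd u F], and likewise for
    [pd v F]; the inequality of [stable_weak] there is the Rayleigh inequality. *)
Lemma rayleigh_restr F : real_stable F -> rayleigh (restr F).
Proof.
move=> /[dup] sF [maF stF cF] x u v.
pose z : V -> C := fun u => (x u)%:C%C.
have := @stable_weak _ _ F (upd z u (z u + 'i%C)) v sF.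
rewrite (multiaffine_upd _ _ _ maF) (multiaffine_upd _ _ _ (multiaffine_pd v maF)).
have -> : z u + 'i%C - z u = 'i%C by rewrite addrAC subrr add0r.
have cv := self_conj_pd v cF; have cu := self_conj_pd u cF.
have cuv := self_conj_pd u cv.
rewrite (restrE x cF) (restrE x cv) (restrE x cu) (restrE x cuv) !restr_pd.
rewrite /= !(mul0r, mul1r, subr0, addr0, add0r, mulr0, sub0r, mulrN).
have z0 w : 0 <= Im (upd z u (z u + 'i%C) w).
  by rewrite /upd; case: eqP => _ /=; rewrite ?addr0 ?add0r.
move=> /(_ z0); lra.
Qed.

End Restriction.

(** * Partial fractions *)

Section PartialFractions.
Variable R : rcfType.
Local Notation C := R[i].
Implicit Types (a g p q d : {poly C}) (w z l : C) (k : nat).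

Lemma Im_mul_conj_scale z w :
  Im (z * (w * conjc w)) = Im z * (Re w ^+ 2 + Im w ^+ 2).
Proof. by case: z => a b; case: w => c d /=; ring. Qed.

Lemma horner_map_conj p (t : R) : (map_poly conjc p).[t%:C%C] = conjc p.[t%:C%C].
Proof. by rewrite -[in LHS](conjc_real t) horner_map. Qed.

(* Dominant behaviour of [Im t * Im (g t * conjc (a t))] along the ray
   [t = l + rho * w], [rho -> 0], at a root [l] of order [k] of [a]. *)
Lemma ray_limit g b d l w k :
  (0 < k)%N -> d != 0 ->
  (forall t, d.[t] != 0 ->
     Im t * Im (g.[t] * conjc ((t - l) ^+ k * b.[t])) <= 0) ->
  (if Im l == 0 then Im w else Im l) *
    Im (g.[l] * conjc b.[l] * conjc (w ^+ k)) <= 0.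
Proof.
move=> k0 d0 H; set s := if _ then _ else _.
have [->|w0] := eqVneq w 0; first by rewrite expr0n gtn_eqF// conjc0 mulr0 mulr0.
pose L : {poly C} := l%:P + w *: 'X.
have LE t : L.[t] = l + t * w by rewrite /L !hornerE mulrC.
have sL : size L = 2.
  by rewrite /L addrC size_polyDl ?size_scale ?size_polyX//
    (leq_ltn_trans (size_polyC_leq1 l)).
pose W := (s%:C%C * conjc (w ^+ k))%:P * ((g \Po L) * map_poly conjc (b \Po L)).
have WE (t : R) : W.[t%:C%C] =
    s%:C%C * (g.[l + t%:C%C * w] * conjc b.[l + t%:C%C * w] * conjc (w ^+ k)).
  rewrite /W hornerM hornerC hornerM horner_map_conj !horner_comp LE.
  by rewrite -[LHS]mulrA [X in _ * X]mulrC.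
have -> : s * Im (g.[l] * conjc b.[l] * conjc (w ^+ k)) = Im W.[0].
  by rewrite -(rmorph0 (real_complex R)) WE rmorph0 mul0r addr0 ImM /= mul0r addr0.
(* Within this radius [Im (l + t * w)] keeps the sign of [Im l] when [l] is not real. *)
pose e := if Im l == 0 then 1 else `|Im l| / (`|Im w| + 1).
have e0 : 0 < e.
  rewrite /e; case: eqP => // /eqP l0.
  by rewrite divr_gt0 ?normr_gt0// ltr_wpDl.
apply: (@Im_poly_le0 _ _ (d \Po L) e) => // [|t t0 te].
  by rewrite comp_poly2_eq0.
rewrite horner_comp LE => /H; rewrite WE addrAC subrr add0r.
set x := l + _; rewrite exprMn -rmorphXn !rmorphM/= oppr0.
set X := g.[x] * conjc b.[x] * conjc (w ^+ k) => hX.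
rewrite ImM /= mul0r addr0.
have {hX}: Im x * Im X <= 0.
  move: hX; rewrite (_ : g.[x] * _ = (t ^+ k)%:C%C * X); last first.
    rewrite /X; case: (conjc _) => ? ?; case: (conjc _) => ? ?.
    by case: g.[x] => ? ? /=; congr (_ +i* _)%C; ring.
  by rewrite ImM /= mul0r addr0 mulrCA pmulr_rle0 ?exprn_gt0.
rewrite {1}/x ImD ImM /= mul0r addr0 /s.
have [->|l0] := eqVneq (Im l) 0; first by rewrite add0r -mulrA pmulr_rle0.
have : `|t * Im w| < `|Im l|.
  rewrite normrM gtr0_norm//; apply: le_lt_trans (_ : t * (`|Im w| + 1) < _).
    by rewrite ler_pM2l// lerDl ler01.
  by rewrite -ltr_pdivlMr ?ltr_wpDl// -/e; move: te; rewrite /e (negbTE l0).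
move: (Im l) (t * Im w) l0 (Im X) => u v u0 y uv h.
have [u_gt|u_lt|u_eq] := ltgtP u 0; last by rewrite u_eq eqxx in u0.
- move: uv; rewrite (ltr0_norm u_gt) ltr_norml => /andP[uv1 uv2].
  by rewrite nmulr_rle0//; move: h; rewrite nmulr_rle0//; lra.
- move: uv; rewrite (gtr0_norm u_lt) ltr_norml => /andP[uv1 uv2].
  by rewrite pmulr_rle0//; move: h; rewrite pmulr_rle0//; lra.
Qed.

(** A [k]-th root [w] of [- i s z] would give the expression the value [s^2 |z|^2]. *)
Lemma ray_nonreal (s : R) z k : (0 < k)%N -> s != 0 ->
  (forall w, s * Im (z * conjc (w ^+ k)) <= 0) -> z = 0.
Proof.
move=> k0 s0 H; apply/eqP; apply: contraT => /sqnormc_gt0 z0.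
have := H (k.-root ((0 -i* s)%C * z)); rewrite rootCK//.
rewrite (_ : Im _ = s * (Re z ^+ 2 + Im z ^+ 2)); last first.
  by case: (z) => a b /=; ring.
by rewrite mulrA pmulr_lle0// -expr2 real_exprn_even_le0 ?num_real//= (negbTE s0).
Qed.

(** The multiples [w * u ^+ j] of [w] by [k]-th roots of unity share the same [k]-th power, and
    their imaginary parts sum to 0. The sign condition then forces [w] to be real whenever
    [Im (z * conjc (w ^+ k))] is nonzero. *)
Lemma ray_multiple z k : (1 < k)%N ->
  (forall w, Im w * Im (z * conjc (w ^+ k)) <= 0) -> z = 0.
Proof.
move=> k1 H; apply/eqP; apply: contraT => /sqnormc_gt0 z0.
have k0 : (0 < k)%N by apply: ltn_trans k1.
have [u] : exists u : C, root (\poly_(i < k) 1) u.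
  apply/closed_rootP; rewrite size_poly_eq ?oner_neq0//.
  by case: (k) k1 => [|[]].
rewrite /root horner_poly => /eqP u_sum.
have {}u_sum : \sum_(i < k) u ^+ i = 0.
  by rewrite -[RHS]u_sum; apply: eq_bigr => i _; rewrite mul1r.
have uk : u ^+ k = 1 by apply/eqP; rewrite -subr_eq0 subrX1 u_sum mulr0.
have real_root w : Im (z * conjc (w ^+ k)) != 0 -> Im w = 0.
  set s := Im (z * _) => s0.
  have sum0 : \sum_(j < k) - (Im (w * u ^+ j) * s) = 0.
    by rewrite sumrN -mulr_suml -Im_sum -mulr_sumr u_sum mulr0 mul0r oppr0.
  move/eqP: sum0; rewrite psumr_eq0 => [/allP|j _]; last first.
    rewrite oppr_ge0; have := H (w * u ^+ j).
    by rewrite exprMn -exprM mulnC exprM uk expr1n mulr1.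
  move=> /(_ (Ordinal k0) (mem_index_enum _)) /=.
  by rewrite expr0 mulr1 oppr_eq0 mulf_eq0 (negbTE s0) orbF => /eqP.
have real_pow w : Im w = 0 -> Im (w ^+ k) = 0.
  by case: w => a b /= ->; rewrite -[(a +i* 0)%C]/(a%:C%C) -rmorphXn.
(* A [k]-th root of [c * z] must be real, hence so is [c * z]; the values [i] and [1 + i] of [c]
   then kill [z]. *)
have h c : Re c ^+ 2 + Im c ^+ 2 != 0 -> Im c != 0 -> Im (c * z) = 0.
  move=> c0 cI; rewrite -(rootCK k0 (c * z)); apply: real_pow; apply: real_root.
  rewrite rootCK// (_ : Im _ = - Im c * (Re z ^+ 2 + Im z ^+ 2)).
    by rewrite mulf_neq0 ?oppr_eq0// gt_eqF.
  by case: (z) (c) => ? ? [? ?] /=; ring.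
have h1 := h 'i%C; have h2 := h (1 +i* 1)%C.
move: z0 h1 h2; case: (z) => p q /=; rewrite expr0n expr1n add0r oner_neq0.
rewrite !mul0r !mul1r !add0r => pq /(_ isT isT) p0.
rewrite -mulr2n pnatr_eq0 => /(_ isT isT); rewrite p0 addr0 => q0.
by move: pq; rewrite p0 q0 expr0n addr0 ltxx.
Qed.

Lemma ray_simple z :
  (forall w, Im w * Im (z * conjc w) <= 0) -> Im z = 0 /\ 0 <= Re z.
Proof.
case: z => p q /= H.
have h x : q * x <= p by have := H (x +i* 1)%C => /=; lra.
split; last by have := h 0; rewrite mulr0.
apply/eqP; apply: contraT => q0; have := h ((p + 1) / q).
by rewrite mulrC divfK//; lra.
Qed.

(** The sign condition says that [g / a] maps the upper half-plane to the closed lower one. Near a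
    nonreal or multiple pole it would take values of both signs, so the pole is real and simple,
    with residue [r >= 0]. *)
Lemma coprime_pole a g d l : a != 0 -> d != 0 -> coprimep a g -> root a l ->
  (forall t, d.[t] != 0 -> Im t * Im (g.[t] * conjc a.[t]) <= 0) ->
  let b := a %/ ('X - l%:P) in
  [/\ Im l = 0, a = ('X - l%:P) * b, b.[l] != 0 &
      exists2 r : R, 0 <= r & g.[l] = r%:C%C * b.[l]].
Proof.
move=> a0 d0 cop al H /=.
have gl := coprimep_root cop al.
have [k [b rb aE]] := multiplicity_XsubC a l; rewrite a0 implyTb in rb.
have k0 : (0 < k)%N.
  by rewrite lt0n; apply: contraTneq al => kE; rewrite aE kE expr0 mulr1.
have ray w : (if Im l == 0 then Im w else Im l) *
    Im (g.[l] * conjc b.[l] * conjc (w ^+ k)) <= 0.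
  apply: (ray_limit _ k0 d0) => t /H.
  by rewrite aE hornerM horner_exp hornerXsubC [b.[t] * _]mulrC.
have z0 : g.[l] * conjc b.[l] != 0 by rewrite mulf_neq0// conjc_eq0.
have l0 : Im l = 0.
  apply/eqP; apply: contraNT z0 => l0; apply/eqP.
  by apply: (ray_nonreal k0 l0) => w; have := ray w; rewrite /= (negbTE l0).
rewrite l0 eqxx /= in ray.
have k1 : k = 1.
  apply/eqP; rewrite eqn_leq k0 andbT leqNgt; apply: contraNN z0 => k1.
  by apply/eqP; apply: (ray_multiple k1).
have bE : a %/ ('X - l%:P) = b by rewrite aE k1 expr1 mulpK ?polyXsubC_eq0.
rewrite bE; split=> //; first by rewrite aE k1 expr1 mulrC.
have [zI zR] : Im (g.[l] * conjc b.[l]) = 0 /\ 0 <= Re (g.[l] * conjc b.[l]).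
  by apply: ray_simple => w; have := ray w; rewrite k1 expr1.
have n0 := sqnormc_gt0 rb.
exists (Re (g.[l] * conjc b.[l]) / (Re b.[l] ^+ 2 + Im b.[l] ^+ 2)).
  by rewrite divr_ge0// ltW.
move: rb n0 zI; case: (g.[l]) => p q; case: b.[l] => u v /= _ n0 zI.
apply/eqP; rewrite eq_complex /= !mul0r subr0 addr0.
have n1 : u ^+ 2 + v ^+ 2 != 0 by rewrite gt_eqF.
apply/andP; split; apply/eqP; apply: (mulIf n1).
  rewrite mulrAC divfK//; have e : v * (p * - v + q * u) = 0 by rewrite zI mulr0.
  by apply/eqP; rewrite -subr_eq0 -oppr_eq0 -e; apply/eqP; ring.
rewrite mulrAC divfK//; have e : u * (p * - v + q * u) = 0 by rewrite zI mulr0.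
by apply/eqP; rewrite -subr_eq0 -e; apply/eqP; ring.
Qed.

(** This is [g / a = c + \sum r x / ('X - x)] cleared of denominators, [al x] being [a / ('X - x)].
    Common factors are divided out first so that [coprime_pole] applies, and restored at the end. *)
Lemma partial_fractions a g : a != 0 -> (size g <= size a)%N ->
  (forall t, Im t * Im (g.[t] * conjc a.[t]) <= 0) ->
  exists (rs : seq R) (r : R -> R) (al : R -> {poly C}) (c : C),
    (forall x, x \in rs -> 0 <= r x /\ a = ('X - (x%:C%C)%:P) * al x) /\
    g = c *: a + \sum_(x <- rs) (r x)%:C%C *: al x.
Proof.
move=> a0 sga H.
pose d : {poly C} := gcdp a g.
pose a1 : {poly C} := a %/ d; pose g1 : {poly C} := g %/ d.
have aE : a = a1 * d by rewrite divpK// dvdp_gcdl.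
have gE : g = g1 * d by rewrite divpK// dvdp_gcdr.
have cop : coprimep a1 g1 by rewrite coprimep_div_gcd// a0.
have [a10 d0] : a1 != 0 /\ d != 0.
  by apply/andP; rewrite -negb_or -mulf_eq0 -aE.
have H1 (t : C) : d.[t] != 0 -> Im t * Im (g1.[t] * conjc a1.[t]) <= 0.
  move=> /sqnormc_gt0 dt; have := H t; rewrite aE gE !hornerM.
  rewrite (rmorphM conjc)
    [X in _ * Im X](_ : _ = g1.[t] * conjc a1.[t] * (d.[t] * conjc d.[t])).
    by rewrite Im_mul_conj_scale (mulrA (Im t)) (pmulr_lle0 _ dt).
  by rewrite mulrACA.
have pole l (al : root a1 l) := coprime_pole a10 d0 cop al H1.
have [rs rsE] := closed_field_poly_normal a1.
have lc0 : lead_coef a1 != 0 by rewrite lead_coef_eq0.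
have rsP l : (l \in rs) = root a1 l by rewrite rsE rootZ// root_prod_XsubC.
have size_rs : size a1 = (size rs).+1.
  by rewrite rsE size_scale// size_prod_XsubC.
have rs_uniq : uniq rs.
  apply: count_mem_uniq => l; have [lrs|] := boolP (l \in rs); last first.
    by move/count_memPn.
  have rem1 := perm_to_rem lrs.
  rewrite (permP rem1) /= eqxx; congr S; apply/count_memPn/negP => lrem.
  have al : root a1 l by rewrite -rsP.
  have [_ a1E /negP bl _] := pole l al; apply: bl.
  have XE : ('X - l%:P) * (a1 %/ ('X - l%:P)) =
      ('X - l%:P) * (lead_coef a1 *: \prod_(z <- rem l rs) ('X - z%:P)).
    by rewrite -a1E {1}rsE (perm_big _ rem1) big_cons scalerAr.
  have -> := mulfI _ XE; last by rewrite polyXsubC_eq0.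
  by rewrite -/(root _ _) rootZ// root_prod_XsubC.
pose b l := a1 %/ ('X - l%:P).
pose r l := Re (g1.[l] / (b l).[l]).
have poleP l : l \in rs -> [/\ Im l = 0, a1 = ('X - l%:P) * b l, (b l).[l] != 0,
    0 <= r l & g1.[l] = (r l)%:C%C * (b l).[l]].
  rewrite rsP => /pole[l0 bE bl [s s0 sE]]; split=> //; rewrite /r sE mulfK//.
pose n := size rs.
(* This choice cancels the coefficient of degree [n], so the difference [q] below has degree less
   than [n] while vanishing at the [n] distinct roots. *)
pose c := g1`_n / lead_coef a1.
have size_g1 : (size g1 <= n.+1)%N.
  have [->|g10] := eqVneq g1 0; first by rewrite size_poly0.
  move: sga; rewrite aE gE !size_mul// size_rs.
  move: d0; rewrite -size_poly_gt0; case: (size d) => // k _.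
  by rewrite !addnS leq_add2r.
have size_b l : l \in rs -> (size (b l) <= n)%N.
  move=> lrs; have [_ a1E bl _ _] := poleP l lrs.
  have b0 : b l != 0 by apply: contraNneq bl => ->; rewrite horner0.
  have := size_rs; rewrite {1}a1E size_mul ?polyXsubC_eq0// size_XsubC /=.
  by case=> h; rewrite -[n]h.
have g1E : g1 = c *: a1 + \sum_(l <- rs) (r l)%:C%C *: b l.
  apply/eqP; rewrite -subr_eq0; set q := _ - _; apply: contraT => q0.
  have : (size rs < size q)%N.
    apply: max_poly_roots => //; apply/allP => l lrs.
    rewrite /root /q hornerD hornerN hornerD hornerZ horner_sum.
    have [l0 a1E bl rl gl] := poleP l lrs.
    have -> : a1.[l] = 0 by apply/eqP; rewrite -/(root a1 l) -rsP.
    rewrite (bigD1_seq l)//= big1_seq => [|z /andP[zl zrs]].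
      by rewrite hornerZ -gl mulr0 add0r addr0 subrr.
    rewrite hornerZ; have [_ a1E' _ _ _] := poleP z zrs.
    have : a1.[l] = 0 by apply/eqP; rewrite -/(root a1 l) -rsP.
    rewrite a1E' hornerM hornerXsubC => /eqP.
    by rewrite mulf_eq0 subr_eq0 eq_sym (negbTE zl) => /eqP ->; rewrite mulr0.
  rewrite ltnNge => /negP[]; apply/leq_sizeP => j nj.
  rewrite coefB coefD coefZ coef_sum big_seq big1 ?addr0; last first.
    move=> l lrs; rewrite coefZ nth_default ?mulr0//.
    by apply: leq_trans (size_b l lrs) _.
  have [->|jn] := eqVneq j n.
    have lcE : a1`_n = lead_coef a1 by rewrite lead_coefE size_rs.
    by rewrite /c lcE divfK// subrr.
  have nj' : (n < j)%N by rewrite ltn_neqAle eq_sym jn.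
  by rewrite !nth_default ?mulr0 ?subr0// ?size_rs//; apply: leq_trans nj'.
exists (map (@complex.Re R) rs), (fun x => r x%:C%C), (fun x => b x%:C%C * d), c.
have real l : l \in rs -> (Re l)%:C%C = l.
  by case: l => u v /poleP[/= -> _ _ _ _].
split=> [_ /mapP[l lrs ->]|].
  rewrite real//; have [_ a1E _ r0 _] := poleP l lrs.
  by rewrite {1}aE {1}a1E mulrA.
rewrite gE {1}g1E mulrDl aE scalerAl; congr (_ + _).
rewrite big_map mulr_suml !big_seq; apply: eq_bigr => l lrs.
by rewrite real// scalerAl.
Qed.

End PartialFractions.

(** * The barrier argument *)

Section Barrier.
Variable R : rcfType.
Local Notation C := R[i].
Local Notation toC := (real_complex R).

Lemma poly_eq_real (p q : {poly C}) :
  (forall t : R, p.[t%:C%C] = q.[t%:C%C]) -> p = q.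
Proof.
move=> pq; apply/eqP; rewrite -subr_eq0; apply: contraT => pq0.
have := @max_poly_roots _ _ [seq (k%:R)%:C%C | k <- iota 0 (size (p - q))] pq0.
rewrite size_map size_iota ltnn => /(_ _ _)/wrap[]//.
  by apply/allP => _ /mapP[k _ ->]; rewrite /root !hornerE pq subrr.
rewrite map_inj_uniq ?iota_uniq// => j k /complexI /eqP.
by rewrite eqr_nat => /eqP.
Qed.

(** If [g] had larger degree, [g] and [g - phi *: a] would share a leading coefficient, which the
    bounds at infinity make both nonnegative and nonpositive. *)
Lemma size_le_of_bounded (a g : {poly R}) (phi : R) :
  (forall t, 0 <= t -> 0 <= g.[t] <= phi * a.[t]) -> (size g <= size a)%N.
Proof.
move=> H; rewrite leqNgt; apply/negP => sag.
have eventually_le0 (p : {poly R}) :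
    (forall t, 0 <= t -> p.[t] <= 0) -> lead_coef p <= 0.
  move=> p0; rewrite leNgt; apply/negP => lp.
  have [n Hn] := poly_pinfty_gt_lc lp.
  have := Hn (Num.max n 0); rewrite le_max lexx => /(_ isT); apply/negP.
  by rewrite -ltNge (le_lt_trans _ lp)// p0// le_max lexx orbT.
have lg0 : lead_coef g != 0.
  by rewrite lead_coef_eq0 -size_poly_gt0 (leq_ltn_trans _ sag).
have : lead_coef (- g) <= 0.
  by apply: eventually_le0 => t /H/andP[]; rewrite hornerN oppr_le0.
rewrite lead_coefN oppr_le0 le_eqVlt eq_sym (negbTE lg0) /= => lg.
have : lead_coef (g - phi *: a) <= 0.
  by apply: eventually_le0 => t /H/andP[_]; rewrite !hornerE subr_le0.
rewrite lead_coefDl ?leNgt ?lg// size_polyN.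
by apply: leq_ltn_trans sag; apply: size_scale_leq.
Qed.

(* By partial fractions, [g / a] is a constant plus a sum of terms
   [r x / ('X - x)] with [x < 0 <= r x]; the inequality holds term by term. *)
Lemma barrier_line (a g : {poly R}) (t delta B : R) :
  0 < t -> 0 <= delta -> t <= delta * (1 - t * B) ->
  (forall s, 0 <= s -> 0 < a.[s]) ->
  (forall s, 0 <= s -> 0 <= g.[s] <= g.[0] / a.[0] * a.[s]) ->
  a^`().[delta] <= B * a.[delta] ->
  (forall z : C,
    Im z * Im ((map_poly toC g).[z] * conjc (map_poly toC a).[z]) <= 0) ->
  a.[0] * (g.[delta] - t * g^`().[delta]) <=
  g.[0] * (a.[delta] - t * a^`().[delta]).
Proof.
move=> t0 d0 tB a_gt0 gle aB H.
have a0 : a != 0.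
  by apply: contraTneq (a_gt0 0 (lexx _)) => ->; rewrite horner0 ltxx.
have [||rs [r [al [c [rsP gE]]]]] :=
  @partial_fractions _ (map_poly toC a) (map_poly toC g) _ _ H.
- by rewrite map_poly_eq0.
- by rewrite !size_map_poly; apply: size_le_of_bounded gle.
have ad := a_gt0 delta d0; have a00 := a_gt0 0 (lexx _).
have toCB (u v : R) : (u - v)%:C%C = u%:C%C - v%:C%C by rewrite rmorphB.
have toCM (u v : R) : (u * v)%:C%C = u%:C%C * v%:C%C by rewrite rmorphM.
have hornerC (p : {poly R}) s : (map_poly toC p).[s%:C%C] = (p.[s])%:C%C.
  by rewrite horner_map.
have neg x : x \in rs -> x < 0.
  move=> xrs; rewrite ltNge; apply/negP => /a_gt0 ax.
  have [_ aE] := rsP x xrs; have := hornerC a x.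
  by rewrite aE hornerM hornerXsubC subrr mul0r => /esym[] e; rewrite e ltxx in ax.
pose L s x := a.[s] / (s - x).
have LE s x : 0 <= s -> x \in rs -> (al x).[s%:C%C] = (L s x)%:C%C.
  move=> s0 xrs; have xn := neg x xrs; have [_ aE] := rsP x xrs.
  have sx : s - x != 0 by rewrite gt_eqF//; lra.
  apply: (mulfI (_ : (s - x)%:C%C != 0)); first by rewrite fmorph_eq0.
  transitivity (a.[s])%:C%C; last by rewrite -rmorphM /L [(s - x) * _]mulrC divfK.
  by rewrite -hornerC aE hornerM hornerXsubC toCB.
(* The derivative of [al x] at [delta], found by differentiating [a = ('X - x) * al x]. *)
pose L' x := (a^`().[delta] - L delta x) / (delta - x).
have LE' x : x \in rs -> (al x)^`().[delta%:C%C] = (L' x)%:C%C.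
  move=> xrs; have xn := neg x xrs; have [_ aE] := rsP x xrs.
  have sx : delta - x != 0 by rewrite gt_eqF//; lra.
  apply: (mulfI (_ : (delta - x)%:C%C != 0)); first by rewrite fmorph_eq0.
  transitivity (a^`().[delta] - L delta x)%:C%C; last first.
    by rewrite -rmorphM /L' [(delta - x) * _]mulrC divfK.
  rewrite [RHS]toCB -LE// -hornerC -deriv_map aE derivM derivXsubC mul1r.
  by rewrite hornerD hornerM hornerXsubC toCB; ring.
have gE0 : (g.[0])%:C%C = c * (a.[0])%:C%C + (\sum_(x <- rs) r x * L 0 x)%:C%C.
  rewrite -!hornerC gE hornerD hornerZ horner_sum rmorph_sum; congr (_ + _).
  by apply: eq_big_seq => x xrs; rewrite hornerZ LE//; apply/esym/toCM.
have gEd : (g.[delta])%:C%C =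
    c * (a.[delta])%:C%C + (\sum_(x <- rs) r x * L delta x)%:C%C.
  rewrite -!hornerC gE hornerD hornerZ horner_sum rmorph_sum; congr (_ + _).
  by apply: eq_big_seq => x xrs; rewrite hornerZ LE//; apply/esym/toCM.
have gEd' : (g^`().[delta])%:C%C =
    c * (a^`().[delta])%:C%C + (\sum_(x <- rs) r x * L' x)%:C%C.
  rewrite -!hornerC -!deriv_map gE derivD derivZ hornerD hornerZ linear_sum.
  rewrite horner_sum rmorph_sum; congr (_ + _).
  by apply: eq_big_seq => x xrs; rewrite /= derivZ hornerZ LE'//; apply/esym/toCM.
rewrite -subr_ge0; set D := _ - _.
(* The constant [c] contributes a multiple of [a] to [g], which cancels in [D]. *)
have -> : D = \sum_(x <- rs) r x *
    (L 0 x * (a.[delta] - t * a^`().[delta]) - a.[0] * (L delta x - t * L' x)).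
  apply: complexI; rewrite /D !(toCB, toCM) gE0 gEd gEd'.
  have -> : \sum_(x <- rs) r x *
    (L 0 x * (a.[delta] - t * a^`().[delta]) - a.[0] * (L delta x - t * L' x)) =
    (\sum_(x <- rs) r x * L 0 x) * (a.[delta] - t * a^`().[delta]) -
    a.[0] * (\sum_(x <- rs) r x * L delta x - t * \sum_(x <- rs) r x * L' x).
    rewrite mulr_suml mulr_sumr -sumrB mulr_sumr -sumrB.
    by apply: eq_bigr => x _; ring.
  by rewrite !(toCB, toCM); ring.
rewrite big_seq; apply: sumr_ge0 => x xrs; have [r0 _] := rsP x xrs.
apply: mulr_ge0 => //; have := neg x xrs; rewrite -oppr_gt0.
rewrite /L' /L; set y := - x => y0.
set u := a.[delta] in ad aB *; set u' := a^`().[delta] in aB *.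
set w := a.[0] in a00 *.
have dy : 0 < delta + y by lra.
have -> : w / (0 + y) * (u - t * u') -
   w * (u / (delta + y) - t * ((u' - u / (delta + y)) / (delta + y))) =
   w / (y * (delta + y)) *
   (u * (delta - t * (y / (delta + y))) - t * delta * u').
  by field; rewrite ?add0r !gt_eqF.
apply: mulr_ge0; first by rewrite divr_ge0 ?mulr_ge0 ?ltW.
(* With this and [u' <= B * u], the bracket is at least [u * (delta * (1 - t * B) - t)], nonnegative
   by the choice of [delta]. *)
have yd : y / (delta + y) <= 1 by rewrite ler_pdivrMr ?mul1r; lra.
apply: (@le_trans _ _ (u * (delta - t) - t * delta * (B * u))).
  rewrite (_ : _ - _ = u * (delta * (1 - t * B) - t)); last by ring.
  by rewrite mulr_ge0 ?(ltW ad)// subr_ge0.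
apply: lerB.
  by rewrite ler_pM2l// lerB// ler_piMr// ltW.
by rewrite ler_wpM2l// mulr_ge0// ltW.
Qed.

Variable V : finType.
Implicit Types (F : (V -> C) -> C) (b : V -> R) (g : {set V}).

Lemma pd_ge0 (f : (V -> R) -> R) b v : multiaffine f -> above b f ->
  forall y, (forall u, b u <= y u) -> 0 <= pd v f y.
Proof.
move=> maf bf y by_; apply: (@ge0_slope _ (f y)) => s s0.
have := bf (upd y v (y v + s)).
rewrite multiaffine_upd// (addrC (y v)) addrK => /(_ _)/wrap[|/ltW//].
by apply: le_upd => //; have := by_ v; lra.
Qed.

(** The ratios decrease, so the bound [B] on their sum at the corner holds on the whole orthant, and
    [step t g f] is at least [(1 - t * B) * f]. *)
Lemma above_step_self (f : (V -> R) -> R) b g (t B : R) :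
  0 < t -> multiaffine f -> rayleigh f -> above b f ->
  \sum_(u in g) pd u f b <= B * f b -> t * B < 1 -> 
  (forall y, (forall u, b u <= y u) -> \sum_(u in g) pd u f y <= B * f y) /\
  above b (step t g f).
Proof.
move=> t0 maf rf bf fB tB.
have bb u : b u <= b u by [].
have fBy y : (forall u, b u <= y u) -> \sum_(u in g) pd u f y <= B * f y.
  move=> by_; have fy := bf y by_; have fb := bf b bb.
  rewrite -ler_pdivrMr//; apply: (@le_trans _ _ ((\sum_(u in g) pd u f b) / f b)).
    by rewrite !mulr_suml; apply: ler_sum => u _; apply: (rayleigh_decr u maf rf bf).
  by rewrite ler_pdivrMr.
split=> // y by_; have fy := bf y by_.
rewrite /step subr_gt0; apply: (@le_lt_trans _ _ (t * (B * f y))).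
  by rewrite ler_pM2l// fBy.
by rewrite mulrA gtr_pMl.
Qed.

(** Moving the corner by [delta] in the coordinates of [g] makes up for the operator: the bound
    [alpha] on the ratio in direction [v] survives. On the line from [b] in direction [g] this is
    [barrier_line]. *)
Lemma barrier_step F b b' g v (t delta alpha B : R) :
  real_stable F -> above b (restr F) -> 0 < t -> 0 <= delta ->
  \sum_(u in g) pd u (restr F) b <= B * restr F b ->
  t * B < 1 -> t <= delta * (1 - t * B) ->
  pd v (restr F) b <= alpha * restr F b ->
  b' = (fun u => b u + delta * (u \in g)%:R) ->
  pd v (step t g (restr F)) b' <= alpha * step t g (restr F) b'.
Proof.
move=> /[dup] sF [maF stF cF] bf t0 d0 fB tB tdB va b'E0.
set f := restr F in bf fB va *.
have maf : multiaffine f by apply: multiaffine_restr.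
have rf : rayleigh f by apply: rayleigh_restr.
have mag := multiaffine_pd v maf.
pose d u : R := (u \in g)%:R.
have d_ge0 u : 0 <= d u by rewrite ler0n.
have [a aP] := multiaffine_line b d maf.
have [h hP] := multiaffine_line b d mag.
pose dC u : C := (d u)%:C%C; pose bC u : C := (b u)%:C%C.
have [aC aCP] := multiaffine_line bC dC maF.
have [hC hCP] := multiaffine_line bC dC (multiaffine_pd v maF).
have lineE (s : R) : (fun u => bC u + s%:C%C * dC u) =
    fun u => (b u + s * d u)%:C%C.
  by apply/funext => u; rewrite /bC /dC rmorphD rmorphM.
have aCE : aC = map_poly toC a.
  apply: poly_eq_real => s; rewrite horner_map; have [<- _] := aCP s%:C%C.
  by rewrite lineE restrE//; have [<- _] := aP s.
have hCE : hC = map_poly toC h.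
  apply: poly_eq_real => s; rewrite horner_map; have [<- _] := hCP s%:C%C.
  by rewrite lineE restrE ?restr_pd//; [have [<- _] := hP s|apply: self_conj_pd].
have by_ s : 0 <= s -> forall u, b u <= b u + s * d u.
  by move=> s0 u; rewrite lerDl mulr_ge0.
have sum_d (G : V -> R) : \sum_u d u * G u = \sum_(u in g) G u.
  rewrite [RHS]big_mkcond; apply: eq_bigr => u _; rewrite /d.
  by case: (u \in g); rewrite ?mul1r ?mul0r.
have b'E : (fun u => b u + delta * d u) = b' by rewrite b'E0.
have stepE G p : (forall s, G (fun u => b u + s * d u) = p.[s] /\
    \sum_u d u * pd u G (fun u => b u + s * d u) = p^`().[s]) ->
    step t g G b' = p.[delta] - t * p^`().[delta].
  by move=> /(_ delta)[<- <-]; rewrite b'E sum_d.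
have b0 : (fun u => b u + 0 * d u) = b by apply/funext => u; rewrite mul0r addr0.
have [fBy stf] := above_step_self t0 maf rf bf fB tB.
have bb' : forall u, b u <= b' u by rewrite -b'E; apply: by_.
have bb u : b u <= b u by [].
have key : a.[0] * (h.[delta] - t * h^`().[delta]) <=
    h.[0] * (a.[delta] - t * a^`().[delta]).
  apply: (barrier_line t0 d0 tdB).
  - by move=> s s0; have [<- _] := aP s; apply: bf; apply: by_.
  - move=> s s0; have [<- _] := aP s; have [<- _] := hP s.
    have [<- _] := aP 0; have [<- _] := hP 0; rewrite b0.
    have bs := by_ s s0; rewrite (pd_ge0 _ maf bf)//=.
    by have := rayleigh_decr v maf rf bf bb bs; rewrite ler_pdivrMr// bf.
  - have [<- <-] := aP delta; rewrite b'E sum_d; exact: fBy.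
  move=> z; rewrite -aCE -hCE; have [<- _] := aCP z; have [<- _] := hCP z.
  have upper (w : C) : 0 <= Im w -> Im (pd v F (fun u => bC u + w * dC u) *
      conjc (F (fun u => bC u + w * dC u))) <= 0.
    move=> w0; apply: stable_weak => // u.
    by rewrite ImD ImM /= mulr0 !add0r mulr_ge0.
  have [z0|z0] := leP 0 (Im z); first by rewrite mulr_ge0_le0// upper.
  (* The lower half-plane follows from the upper one by conjugation. *)
  have cz : (fun u => bC u + z * dC u) =
      (fun u => conjc (bC u + conjc z * dC u)).
    apply/funext => u; rewrite /bC /dC; case: (z) => p q.
    by apply/eqP; rewrite eq_complex /=; apply/andP; split; apply/eqP; ring.
  rewrite nmulr_rle0// cz cF (self_conj_pd v cF) conjcK.
  have : 0 <= Im (conjc z) by case: (z) z0 => p q /=; lra.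
  move=> /upper; case: (pd _ _ _) => p q; case: (F _) => p' q' /=; lra.
rewrite pd_step (stepE f a aP) (stepE _ h hP).
have := stf b' bb'; rewrite (stepE f a aP).
have [a0E _] := aP 0; have [h0E _] := hP 0; rewrite b0 in a0E h0E.
have := bf b bb; rewrite -a0E -h0E in key * => fb A0.
rewrite -(ler_pM2l fb); apply: le_trans key _.
rewrite mulrCA mulrA; by rewrite ler_pM2r.
Qed.

End Barrier.

(** * Averaging over colourings and selecting one of them *)

Section Selection.
Variables (R : rcfType) (K : finType) (r : nat).
Local Notation C := R[i].
Local Notation V := (K * 'I_r)%type.
Implicit Types (F : (V -> C) -> C) (b : V -> R) (ks : seq K) (p : K -> 'I_r).

Definition fiber (k : K) : {set V} := [set v | v.1 == k].

(** For [t = rho / r] this is the average of [shifts rho p ks F] over the colourings [p]. *)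
Definition steps (t : R) ks F :=
  foldr (fun k G => step t%:C%C (fiber k) G) F ks.
Definition shifts (t : R) p ks F :=
  foldr (fun k G => step t%:C%C [set (k, p k)] G) F ks.

Lemma card_fiber k : #|fiber k| = r.
Proof.
rewrite (_ : fiber k = [set (k, j) | j : 'I_r]) ?card_imset ?card_ord//.
  by move=> i j [].
apply/setP => -[k' j]; rewrite inE /=; apply/eqP/imsetP => [->|[i _ [->]]//].
by exists j.
Qed.

(** [foldr] applies the head last; commutation lets it act first, as an induction on [ks] with
    varying [F] needs. *)
Lemma steps_cons t k ks F :
  steps t (k :: ks) F = steps t ks (step t%:C%C (fiber k) F).
Proof. by elim: ks => //= k' ks <-; rewrite stepC. Qed.

Lemma steps_step t s g ks F : step s g (steps t ks F) = steps t ks (step s g F).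
Proof. by elim: ks => //= k ks <-; rewrite stepC. Qed.

Lemma shifts_cons t p k ks F :
  shifts t p (k :: ks) F = shifts t p ks (step t%:C%C [set (k, p k)] F).
Proof. by elim: ks => //= k' ks <-; rewrite stepC. Qed.

Lemma real_stable_steps t ks F :
  0 <= t -> real_stable F -> real_stable (steps t ks F).
Proof. by move=> t0 sF; elim: ks => //= k ks; apply: real_stable_step. Qed.

(** Each operator moves the corner by [delta] on its own fibre only. There the [r] ratios sum to at
    most [r * alpha], and [barrier_step] keeps the bound [alpha] for the indices still to come. *)
Lemma above_steps t delta alpha F b b' ks :
  0 < t -> 0 <= delta -> t * (r%:R * alpha) < 1 ->
  t <= delta * (1 - t * (r%:R * alpha)) ->
  uniq ks -> real_stable F -> above b (restr F) ->
  (forall v, v.1 \in ks -> pd v (restr F) b <= alpha * restr F b) ->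
  (forall v, b v <= b' v) ->
  (forall v, v.1 \in ks -> b v + delta <= b' v) ->
  above b' (restr (steps t ks F)).
Proof.
move=> t0 d0 tB tdB; elim: ks F b => [|k ks IHks] F b.
  by move=> _ _ bf _ bb' _; apply: above_le bf.
rewrite steps_cons => /andP[kks uks] sF bf hv bb' hb'.
have sumB : \sum_(u in fiber k) pd u (restr F) b <= r%:R * alpha * restr F b.
  rewrite -mulrA mulr_natl.
  have <- : \sum_(u in fiber k) alpha * restr F b = alpha * restr F b *+ r.
    by rewrite sumr_const card_fiber.
  apply: ler_sum => u; by rewrite inE => /eqP uk; apply: hv; rewrite uk mem_head.
have [maF _ _] := sF.
have [_ stf] := above_step_self t0 (multiaffine_restr maF)
  (rayleigh_restr sF) bf sumB tB.
pose b1 u := b u + delta * (u \in fiber k)%:R.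
have bb1 u : b u <= b1 u by rewrite lerDl mulr_ge0.
apply: (IHks _ b1) => //.
- by apply: real_stable_step => //; apply: ltW.
- by rewrite restr_step; apply: above_le stf.
- move=> v vks; rewrite restr_step.
  apply: (barrier_step sF bf t0 d0 sumB) => //.
  by apply: hv; rewrite inE vks orbT.
- move=> v; rewrite /b1 inE; case: eqP => [vk|_].
    by rewrite mulr1 hb'// vk mem_head.
  by rewrite mulr0 addr0.
move=> v vks; rewrite /b1 inE.
have -> : (v.1 == k) = false by apply/negbTE; apply: contraNneq kks => <-.
by rewrite mulr0 addr0 hb'// inE vks orbT.
Qed.

(** Colours are fixed one index at a time: [above_choice] is applied while the remaining indices are
    still averaged. *)
Lemma above_shifts rho F b ks :
  (0 < r)%N -> 0 < rho -> uniq ks -> real_stable F ->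
  above b (restr (steps (rho / r%:R) ks F)) ->
  exists p, above b (restr (shifts rho p ks F)).
Proof.
move=> r0 rho0; elim: ks F => [|k ks IHks] F /=.
  by move=> _ _ bf; exists (fun=> Ordinal r0).
move=> /andP[kks uks] sF; rewrite -/(steps _ ks F) restr_step.
have t0 : 0 <= rho / r%:R by rewrite divr_ge0 ?(ltW rho0).
have sG := real_stable_steps ks t0 sF; have [maG _ _] := sG.
move=> bf; have [||v] := @above_choice _ _ _ b rho (fiber k) rho0 _
  (multiaffine_restr maG) (rayleigh_restr sG).
- by rewrite card_fiber.
- by rewrite card_fiber.
case: v => k' j; rewrite inE /= => /eqP ->.
rewrite -restr_step steps_step.
case/(IHks _ uks (real_stable_step _ (ltW rho0) sF)) => p hp.
pose p' k' := if k' == k then j else p k'.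
have p'k : p' k = j by rewrite /p' eqxx.
have shiftsE G : shifts rho p' ks G = shifts rho p ks G.
  elim: (ks) kks => //= k1 ks1 IH; rewrite inE negb_or => /andP[kk1 ?].
  by rewrite IH// /p' [k1 == k]eq_sym (negbTE kk1).
exists p'; suff: above b (restr (shifts rho p' (k :: ks) F)) by [].
by rewrite shifts_cons p'k shiftsE.
Qed.

Lemma shiftsE rho p ks F z : uniq ks -> multiaffine F ->
  shifts rho p ks F z =
  F (fun v => z v - (rho * ((v.1 \in ks) && (p v.1 == v.2))%:R)%:C%C).
Proof.
move=> + maF; elim: ks z => [|k ks IHks] z /=.
  by move=> _; congr F; apply/funext => v; rewrite mulr0 rmorph0 subr0.
move=> /andP[kks uks]; rewrite step1; last first.
  by elim: (ks) => //= k' ks' IH; apply: multiaffine_step.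
rewrite -/(shifts rho p ks F) IHks//; congr F; apply/funext => -[k' j] /=.
rewrite /upd xpair_eqE inE; have [->|kk'] := eqVneq k' k.
  rewrite (negbTE kks) /= [j == _]eq_sym; case: eqP => [->|_].
    by rewrite mulr0 mulr1 rmorph0 subr0.
  by rewrite !mulr0 rmorph0 subr0.
by [].
Qed.

(* The barrier argument bounds the averaged polynomial, the interlacing
   argument then selects one term [p] of the average. *)
Theorem shift_selection F (rho alpha delta : R) :
  (0 < r)%N -> 0 < rho -> 0 <= delta ->
  rho * alpha < 1 -> rho / r%:R <= delta * (1 - rho * alpha) ->
  real_stable F -> above (fun=> 0) (restr F) ->
  (forall v, pd v (restr F) (fun=> 0) <= alpha * restr F (fun=> 0)) ->
  exists p : K -> 'I_r, forall y : V -> R, (forall v, delta <= y v) ->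
    0 < restr F (fun v => y v - rho * (p v.1 == v.2)%:R).
Proof.
move=> r0 rho0 d0 ra rd sF bf hv.
have r0' : 0 < r%:R :> R by rewrite ltr0n.
have raE : rho / r%:R * (r%:R * alpha) = rho * alpha by field; rewrite gt_eqF.
have t0 : 0 < rho / r%:R by rewrite divr_gt0.
have := @above_steps (rho / r%:R) delta alpha F (fun=> 0) (fun=> delta) (enum K).
rewrite raE => /(_ t0 d0 ra rd (enum_uniq _) sF bf) /(_ _ _ _)/wrap[]//.
- by move=> v _; rewrite add0r.
case/(above_shifts r0 rho0 (enum_uniq _) sF) => p hp; exists p => y dy.
have [maF _ _] := sF.
have := hp y dy; rewrite {1}/restr shiftsE ?enum_uniq// /restr.
congr (0 < Re (F _)); apply/funext => v.
by rewrite mem_enum rmorphB.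
Qed.

End Selection.

(** * Hermitian matrices and determinants *)

Section Hermitian.
Variable R : rcfType.
Local Notation C := R[i].

Definition ctmx m n (A : 'M[C]_(m, n)) : 'M[C]_(n, m) := map_mx conjc A^T.

Lemma ctmxK m n (A : 'M[C]_(m, n)) : ctmx (ctmx A) = A.
Proof. by apply/matrixP => i j; rewrite !mxE conjcK. Qed.

Lemma ctmx_mul m n p (A : 'M[C]_(m, n)) (B : 'M[C]_(n, p)) :
  ctmx (A *m B) = ctmx B *m ctmx A.
Proof. by rewrite /ctmx trmx_mul map_mxM. Qed.

Lemma ctmxD m n (A B : 'M[C]_(m, n)) : ctmx (A + B) = ctmx A + ctmx B.
Proof. by rewrite /ctmx linearD map_mxD. Qed.

Lemma ctmxZ m n (t : R) (A : 'M[C]_(m, n)) :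
  ctmx (t%:C%C *: A) = t%:C%C *: ctmx A.
Proof.
apply/matrixP => i j; rewrite !mxE (rmorphM conjc); congr (_ * _).
exact: conjc_real.
Qed.

Lemma ctmx_scalar n (t : R) : ctmx (t%:C%C%:M : 'M_n) = t%:C%C%:M.
Proof.
apply/matrixP => i j; rewrite !mxE eq_sym; case: eqP => _; last exact: conjc0.
exact: conjc_real.
Qed.

(** The Euclidean inner product of the underlying real space, so that quadratic forms take values in
    [R]. *)
Definition dotr n (x y : 'cV[C]_n) : R := Re ((ctmx x *m y) 0 0).

Lemma dotrE n (x y : 'cV[C]_n) :
  dotr x y = \sum_i (Re (x i 0) * Re (y i 0) + Im (x i 0) * Im (y i 0)).
Proof.
rewrite /dotr mxE Re_sum; apply: eq_bigr => i _; rewrite !mxE.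
by case: (x i 0) => a b; case: (y i 0) => c d /=; ring.
Qed.

Lemma dotrC n (x y : 'cV[C]_n) : dotr x y = dotr y x.
Proof. by rewrite !dotrE; apply: eq_bigr => i _; ring. Qed.

Lemma dotrDr n (x y z : 'cV[C]_n) : dotr x (y + z) = dotr x y + dotr x z.
Proof. by rewrite /dotr mulmxDr mxE ReD. Qed.

Lemma dotr0r n (x : 'cV[C]_n) : dotr x 0 = 0.
Proof. by rewrite /dotr mulmx0 mxE. Qed.

Lemma dotrZr n (t : R) (x y : 'cV[C]_n) : dotr x (t%:C%C *: y) = t * dotr x y.
Proof. by rewrite /dotr -scalemxAr mxE ReM /= mul0r subr0. Qed.

Lemma dotrDl n (x y z : 'cV[C]_n) : dotr (y + z) x = dotr y x + dotr z x.
Proof. by rewrite ![dotr _ x]dotrC dotrDr. Qed.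

Lemma dotrZl n (t : R) (x y : 'cV[C]_n) : dotr (t%:C%C *: x) y = t * dotr x y.
Proof. by rewrite dotrC dotrZr dotrC. Qed.

Lemma dotr_mull n (A : 'M[C]_n) (x y : 'cV[C]_n) :
  dotr x (A *m y) = dotr (ctmx A *m x) y.
Proof. by rewrite /dotr ctmx_mul ctmxK mulmxA. Qed.

Lemma dotr_ge0 n (x : 'cV[C]_n) : 0 <= dotr x x.
Proof. by rewrite dotrE sumr_ge0// => i _; rewrite -!expr2 addr_ge0 ?sqr_ge0. Qed.

Lemma dotr_gt0 n (x : 'cV[C]_n) : x != 0 -> 0 < dotr x x.
Proof.
move=> x0; rewrite lt_neqAle dotr_ge0 andbT eq_sym dotrE psumr_eq0; last first.
  by move=> i _; rewrite -!expr2 addr_ge0 ?sqr_ge0.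
apply: contra x0 => /allP all0; apply/eqP/matrixP => i j; rewrite ord1 mxE.
have := all0 i (mem_index_enum _); case: (x i 0) => a b /=.
by rewrite -!expr2 paddr_eq0 ?sqr_ge0// !sqrf_eq0 => /andP[/eqP -> /eqP ->].
Qed.

Lemma dotr_iN n (x y : 'cV[C]_n) : dotr ('i%C *: x) y = - dotr x ('i%C *: y).
Proof.
rewrite !dotrE -sumrN; apply: eq_bigr => i _; rewrite !mxE.
by case: (x i 0) => a b; case: (y i 0) => c d /=; ring.
Qed.

Lemma dotr_diag n (w : 'rV[C]_n) (x : 'cV[C]_n) :
  dotr x (diag_mx w *m x) =
  \sum_i Re (w 0 i) * (Re (x i 0) ^+ 2 + Im (x i 0) ^+ 2).
Proof.
rewrite dotrE; apply: eq_bigr => i _; rewrite mul_diag_mx !mxE.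
by case: (x i 0) => a b; case: (w 0 i) => c d /=; ring.
Qed.

Lemma hermitian_spectral n (H : 'M[C]_n) : ctmx H = H ->
  exists (d : 'rV[R]_n) (U : 'M[C]_n), ctmx U *m U = 1%:M /\ U *m ctmx U = 1%:M /\
    H = ctmx U *m diag_mx (map_mx (real_complex R) d) *m U.
Proof.
move=> Hh.
have HH : H \is hermsymmx by apply/is_hermitianmxP; rewrite expr0 scale1r -[LHS]Hh.
have /hermitian_normalmx/orthomx_spectralP HE := HH.
have Uu := spectral_unitarymx H.
have Uct : invmx (spectralmx H) = ctmx (spectralmx H) by rewrite invmx_unitary.
have Uunit := unitarymx_unit Uu.
exists (map_mx (@complex.Re R) (spectral_diag H)), (spectralmx H).
rewrite -Uct; split; [exact: mulVmx|split; [exact: mulmxV|]].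
rewrite {1}HE; congr (_ *m diag_mx _ *m _).
apply/matrixP => i j; rewrite !mxE RRe_real//.
exact: (mxOverP (hermitian_spectral_diag_real HH)).
Qed.

Lemma det_spectral n (d : 'rV[R]_n) (U : 'M[C]_n) (s : R) :
  ctmx U *m U = 1%:M ->
  \det (ctmx U *m diag_mx (map_mx (real_complex R) d) *m U + s%:C%C%:M) =
  (\prod_i (d 0 i + s))%:C%C.
Proof.
move=> UU.
have -> : s%:C%C%:M = ctmx U *m s%:C%C%:M *m U :> 'M[C]_n.
  by rewrite mul_mx_scalar -scalemxAl UU scalemx1.
rewrite -mulmxDl -mulmxDr !det_mulmx mulrAC -det_mulmx UU det1 mul1r.
have -> : diag_mx (map_mx (real_complex R) d) + s%:C%C%:M =
    diag_mx (\row_i (d 0 i + s)%:C%C).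
  apply/matrixP => i j; rewrite !mxE; case: eqP => _; rewrite ?mulr0n ?addr0//.
  by rewrite !mulr1n rmorphD.
by rewrite det_diag rmorph_prod; apply: eq_bigr => i _; rewrite mxE.
Qed.

Lemma det_pos_def n (H : 'M[C]_n) : ctmx H = H ->
  (forall x : 'cV_n, x != 0 -> 0 < dotr x (H *m x)) ->
  exists2 s : R, 0 < s & \det H = s%:C%C.
Proof.
move=> /hermitian_spectral[d [U [UU [UU' HE]]]] Hpos.
exists (\prod_i d 0 i).
  apply: prodr_gt0 => i _.
  (* The eigenvector for [d 0 i], on which the form takes the value [d 0 i]. *)
  have x0 : ctmx U *m delta_mx i (0 : 'I_1) != 0.
    apply/eqP => /(congr1 (mulmx U)); rewrite mulmxA UU' mul1mx mulmx0.
    by move=> /matrixP/(_ i 0); rewrite !mxE !eqxx => /eqP; rewrite oner_eq0.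
  have := Hpos _ x0; rewrite HE -!mulmxA [U *m (_ *m _)]mulmxA UU' mul1mx.
  rewrite dotr_mull ctmxK mulmxA UU' mul1mx dotr_diag (bigD1 i)//= big1 ?addr0.
    by rewrite !mxE !eqxx /= expr1n expr0n addr0 mulr1.
  by move=> k ki; rewrite !mxE (negbTE ki) /= expr0n addr0 mulr0.
have := det_spectral d 0 UU; rewrite -HE (_ : _%:M = 0) ?addr0 => [->|]; last first.
  by apply/matrixP => i j; rewrite !mxE mul0rn.
by congr (_%:C%C); apply: eq_bigr => i _; rewrite addr0.
Qed.

(** A negative eigenvalue [d 0 i] would make the determinant vanish at [s = - d 0 i]. *)
Lemma psd_of_det n (H : 'M[C]_n) : ctmx H = H ->
  (forall s : R, 0 <= s -> \det (H + s%:C%C%:M) != 0) ->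
  forall x : 'cV_n, 0 <= dotr x (H *m x).
Proof.
move=> /hermitian_spectral[d [U [UU [UU' HE]]]] Hdet x.
rewrite HE -!mulmxA dotr_mull ctmxK dotr_diag; apply: sumr_ge0 => i _.
rewrite mulr_ge0 ?addr_ge0 ?sqr_ge0// mxE /= leNgt; apply/negP => di.
have := Hdet (- d 0 i); rewrite HE det_spectral// oppr_ge0 ltW// => /(_ isT).
by rewrite (bigD1 i)//= subrr mul0r rmorph0 eqxx.
Qed.

End Hermitian.

(* Prevents [ring] and [lra] from comparing values of [dotr] by unfolding. *)
Opaque dotr.

(** * Determinantal pencils as real stable functions *)

Section Pencil.
Variables (R : rcfType) (n r : nat).
Local Notation C := R[i].
Variable A : 'M[C]_n.
Hypothesis Aherm : ctmx A = A.
Implicit Types (w : 'I_n -> C) (z : 'I_n * 'I_r -> C).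

Definition pencil w : C := \det (A + diag_mx (\row_i w i)).
Definition pencils z : C := \prod_j pencil (fun i => z (i, j)).

(** Expansion along row [k], whose cofactors do not see coordinate [k]. *)
Lemma pencil_upd w k a : pencil (upd w k a) =
  \sum_j A k j * cofactor (A + diag_mx (\row_i upd w k 0 i)) k j +
  a * cofactor (A + diag_mx (\row_i upd w k 0 i)) k k.
Proof.
rewrite /pencil (expand_det_row _ k).
have cofE j : cofactor (A + diag_mx (\row_i upd w k a i)) k j =
    cofactor (A + diag_mx (\row_i upd w k 0 i)) k j.
  rewrite /cofactor; congr (_ * \det _); apply/matrixP => i l; rewrite !mxE.
  by rewrite /upd ![lift k _ == k]eq_sym (negbTE (neq_lift _ _)).
under eq_bigr do rewrite cofE !mxE mulrDl.
rewrite big_split /=; congr (_ + _).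
rewrite (bigD1 k)//= big1 ?addr0 => [|j jk].
  by rewrite eqxx mulr1n updE.
by rewrite [k == j]eq_sym (negbTE jk) mulr0n mul0r.
Qed.

Lemma multiaffine_pencil : multiaffine pencil.
Proof. by move=> w k a; rewrite /pd !pencil_upd; ring. Qed.

Lemma pencils_upd z k j a : pencils (upd z (k, j) a) =
  pencil (upd (fun i => z (i, j)) k a) *
  \prod_(l | l != j) pencil (fun i => z (i, l)).
Proof.
rewrite /pencils (bigD1 j)//=; congr (_ * _).
  by congr pencil; apply/funext => i; rewrite /upd xpair_eqE eqxx andbT.
apply: eq_bigr => l lj; congr pencil; apply/funext => i.
by rewrite /upd xpair_eqE (negbTE lj) andbF.
Qed.

Lemma multiaffine_pencils : multiaffine pencils.
Proof.
by move=> z [k j] a; rewrite /pd !pencils_upd multiaffine_pencil /pd; ring.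
Qed.

(** By Cramer's rule, the logarithmic derivative at 0 is a diagonal entry of the inverse; this gives
    the initial barrier. *)
Lemma pencils_pd0 k j : A \in unitmx ->
  pd (k, j) pencils (fun=> 0) = invmx A k k * pencils (fun=> 0).
Proof.
move=> Aunit; have ud : \det A != 0 by rewrite -unitfE -unitmxE.
rewrite /pd !pencils_upd -mulrBl /pencils [in RHS](bigD1 j)//= mulrA.
congr (_ * _); rewrite !pencil_upd.
have A0 : A + diag_mx (\row_i upd (fun=> 0) k 0 i) = A.
  apply/matrixP => i l; rewrite !mxE /upd.
  by case: (i == k); rewrite mul0rn addr0.
have A00 : A + diag_mx (\row__ 0) = A.
  by apply/matrixP => i l; rewrite !mxE mul0rn addr0.
rewrite A0 /pencil A00 /invmx Aunit mxE mxE.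
by field.
Qed.

Lemma det_herm_real (H : 'M[C]_n) : conjc (\det H) = \det (ctmx H).
Proof. by rewrite /ctmx det_map_mx det_tr. Qed.

Lemma self_conj_pencils : self_conj pencils.
Proof.
move=> z; rewrite /pencils (rmorph_prod conjc); apply: eq_bigr => j _.
rewrite /pencil -[RHS]/(conjc _) det_herm_real ctmxD Aherm; congr (\det (_ + _)).
apply/matrixP => i k; rewrite !mxE eq_sym; case: eqP => [->|_].
  by rewrite !mulr1n.
by rewrite !mulr0n rmorph0.
Qed.

(** For a kernel vector [u], pairing with ['i *: u] extracts the imaginary part of the form: the
    hermitian [A] contributes nothing, and the diagonal a positive sum. *)
Lemma stable_pencil w : (forall i, 0 < Im (w i)) -> pencil w != 0.
Proof.
move=> w0; rewrite /pencil -det_tr; apply/negP => /det0P[v v0 vA].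
pose u := v^T; have u0 : u != 0.
  by apply: contra v0 => /eqP/(congr1 trmx); rewrite trmxK trmx0 => ->.
have uA : (A + diag_mx (\row_i w i)) *m u = 0.
  by apply: trmx_inj; rewrite trmx_mul trmxK vA trmx0.
move: u u0 uA => {v v0 vA} u u0 uA.
have : dotr ('i%C *: u) ((A + diag_mx (\row_i w i)) *m u) = 0.
  by rewrite uA dotr0r.
rewrite mulmxDl dotrDr.
have -> : dotr ('i%C *: u) (A *m u) = 0.
  have : dotr ('i%C *: u) (A *m u) = - dotr ('i%C *: u) (A *m u).
    by rewrite {1}dotr_iN scalemxAr dotr_mull Aherm dotrC.
  lra.
rewrite add0r dotrE => h.
have : 0 < \sum_i Im (w i) * (Re (u i 0) ^+ 2 + Im (u i 0) ^+ 2).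
  have [i ui] : exists i, u i 0 != 0.
    apply/existsP; apply: contraNT u0 => /existsPn u0; apply/eqP/matrixP => i j.
    by rewrite ord1 [RHS]mxE; apply/eqP; have := u0 i; rewrite negbK.
  rewrite (bigD1 i)//= ltr_pwDl//; first by rewrite mulr_gt0// sqnormc_gt0.
  by apply: sumr_ge0 => k _; rewrite mulr_ge0 ?addr_ge0 ?sqr_ge0// ltW.
rewrite -[X in X < _]h.
have -> // : \sum_i Im (w i) * (Re (u i 0) ^+ 2 + Im (u i 0) ^+ 2) =
  \sum_i (Re (('i%C *: u) i 0) * Re ((diag_mx (\row_i w i) *m u) i 0) +
   Im (('i%C *: u) i 0) * Im ((diag_mx (\row_i w i) *m u) i 0)).
  apply: eq_bigr => i _; rewrite mul_diag_mx !mxE.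
  by case: (u i 0) => a b; case: (w i) => c d /=; ring.
by rewrite ltxx.
Qed.

Lemma real_stable_pencils : real_stable pencils.
Proof.
split; [exact: multiaffine_pencils| |exact: self_conj_pencils].
move=> z z0; rewrite prodf_seq_neq0; apply/allP => j _; apply/implyP => _.
exact: stable_pencil.
Qed.

Lemma restr_pencils (y : 'I_n * 'I_r -> R) :
  (restr pencils y)%:C%C = \prod_j \det (A + diag_mx (\row_i (y (i, j))%:C%C)).
Proof. by rewrite -restrE//; exact: self_conj_pencils. Qed.

Lemma ctmx_pencil (d : 'I_n -> R) :
  ctmx (A + diag_mx (\row_i (d i)%:C%C)) = A + diag_mx (\row_i (d i)%:C%C).
Proof.
rewrite ctmxD Aherm; congr (_ + _); apply/matrixP => i k; rewrite !mxE eq_sym.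
case: eqP => [->|_]; last by rewrite !mulr0n rmorph0.
by rewrite !mulr1n; exact: conjc_real.
Qed.

Lemma dotr_pencil (d : 'I_n -> R) (x : 'cV[C]_n) :
  dotr x ((A + diag_mx (\row_i (d i)%:C%C)) *m x) =
  dotr x (A *m x) + \sum_i d i * (Re (x i 0) ^+ 2 + Im (x i 0) ^+ 2).
Proof.
rewrite mulmxDl dotrDr dotr_diag; congr (_ + _).
by apply: eq_bigr => i _; rewrite mxE.
Qed.

Lemma above_pencils : (forall x : 'cV_n, x != 0 -> 0 < dotr x (A *m x)) ->
  above (fun=> 0) (restr pencils).
Proof.
move=> Apos y y0; rewrite -ltcR restr_pencils; apply: prodr_gt0 => j _.
have [||s s0 ->] := @det_pos_def _ _ (A + diag_mx (\row_i (y (i, j))%:C%C)).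
- exact: ctmx_pencil (fun i => y (i, j)).
- move=> x x0; rewrite (dotr_pencil (fun i => y (i, j))) ltr_pwDl ?Apos//.
  by apply: sumr_ge0 => i _; rewrite mulr_ge0 ?addr_ge0 ?sqr_ge0.
by rewrite ltcR.
Qed.

End Pencil.

(** * One-sided paving of hermitian contractions with zero diagonal *)

Section HermitianPaving.
Variable R : rcfType.
Local Notation C := R[i].

Lemma ctmx_inv n (M : 'M[C]_n) : M \in unitmx -> ctmx M = M ->
  ctmx (invmx M) = invmx M.
Proof.
move=> uM hM; rewrite -[LHS]mulmx1 -(mulmxV uM) mulmxA.
have -> : ctmx (invmx M) *m M = 1%:M.
  by rewrite -{2}hM -ctmx_mul mulmxV// -(rmorph1 (real_complex R)) ctmx_scalar.
by rewrite mul1mx.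
Qed.

(* With [B = M^-1], positivity of the selected pencil says that
   [B + delta - rho * P] is positive semidefinite, [P] being the projection on
   the block; this is tested on the vector [M *m x]. *)
Lemma block_bound n r (M : 'M[C]_n) (rho delta c : R) :
  ctmx M = M -> (forall i, M i i = (2^-1)%:C%C) -> 0 < c ->
  (forall x : 'cV_n, c * dotr x x <= dotr x (M *m x) <= dotr x x) ->
  (0 < r)%N -> 0 < rho -> 0 <= delta ->
  rho / 2 < 1 -> rho / r%:R <= delta * (1 - rho / 2) ->
  exists p : 'I_n -> 'I_r, forall j (x : 'cV_n), (forall i, p i != j -> x i 0 = 0) ->
    dotr x (M *m x) <= (1 + delta) / rho * dotr x x.
Proof.
move=> hM Mii c0 Mx r0 rho0 d0 rho2 rhor.
have Mpos (x : 'cV_n) : x != 0 -> 0 < dotr x (M *m x).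
  move=> /dotr_gt0 x0; have /andP[+ _] := Mx x.
  by apply: lt_le_trans; rewrite mulr_gt0.
have uM : M \in unitmx.
  have [s s0 sE] := det_pos_def hM Mpos.
  by rewrite unitmxE sE unitfE fmorph_eq0 gt_eqF.
pose B := invmx M; have hB : ctmx B = B by apply: ctmx_inv.
have MB (x : 'cV_n) : M *m (B *m x) = x by rewrite mulmxA mulmxV// mul1mx.
have BM (x : 'cV_n) : B *m (M *m x) = x by rewrite mulmxA mulVmx// mul1mx.
have Bpos (x : 'cV_n) : x != 0 -> 0 < dotr x (B *m x).
  move=> x0; rewrite -{1}(MB x) dotrC.
  by apply: Mpos; apply: contra x0 => /eqP Bx; rewrite -(MB x) Bx mulmx0.
(* The initial ratios are the diagonal entries of [invmx B = M], hence [alpha = 2^-1]. *)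
have [||v|p hp] := shift_selection (K := 'I_n) (F := pencils (r := r) B)
  (alpha := 2^-1) r0 rho0 d0 rho2 rhor.
- exact: real_stable_pencils.
- exact: above_pencils.
- rewrite -restr_pd /restr (_ : (fun=> _) = fun=> 0); last by apply/funext.
  case: v => k j; rewrite pencils_pd0 ?unitmx_inv// invmxK Mii.
  by rewrite ReM /= mul0r subr0.
exists p => j x xj.
pose d i : R := delta - rho * (p i == j)%:R.
have hH : ctmx (B + diag_mx (\row_i (d i)%:C%C)) = B + diag_mx (\row_i (d i)%:C%C).
  exact: ctmx_pencil.
have psd := psd_of_det hH _ (M *m x).
have {}psd : 0 <= dotr (M *m x) ((B + diag_mx (\row_i (d i)%:C%C)) *m (M *m x)).
  apply: psd => s s0.
  (* At the constant point [delta + s] the factor of colour [j] is the determinant of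
     [B + diag d + s]. *)
  have := hp (fun=> delta + s) _; rewrite -ltcR restr_pencils//.
  move=> /(_ _)/wrap[|]; first by move=> _; rewrite lerDl.
  move=> /lt0r_neq0; rewrite prodf_seq_neq0 => /allP/(_ j (mem_index_enum _)).
  rewrite implyTb; apply: contra => /eqP <-; apply/eqP; congr (\det _).
  apply/matrixP => i k; rewrite !mxE -[RHS]addrA; congr (_ + _).
  case: (i =P k) => _; last by rewrite !mulr0n addr0.
  rewrite !mulr1n -(rmorphD (real_complex R)); congr (_%:C%C).
  by rewrite /d; ring.
set v := M *m x in psd.
pose m := dotr x v.
have sqE (y : 'cV[C]_n) : dotr y y = \sum_i (Re (y i 0) ^+ 2 + Im (y i 0) ^+ 2).
  by rewrite dotrE; apply: eq_bigr => i _; rewrite !expr2.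
have psd' : rho * (\sum_(i | p i == j) (Re (v i 0) ^+ 2 + Im (v i 0) ^+ 2)) <=
    m + delta * dotr v v.
  have dsum : \sum_i d i * (Re (v i 0) ^+ 2 + Im (v i 0) ^+ 2) = delta * dotr v v -
      rho * (\sum_(i | p i == j) (Re (v i 0) ^+ 2 + Im (v i 0) ^+ 2)).
    rewrite sqE [X in _ - rho * X]big_mkcond !mulr_sumr -sumrB.
    by apply: eq_bigr => i _; rewrite /d; case: eqP => _ /=; ring.
  by move: psd; rewrite dotr_pencil BM dotrC -/m dsum; lra.
(* From [0 <= M <= 1]: the form is nonnegative at [x - v] and at most [dotr v v] at [v]. *)
have vm : dotr v v <= m.
  have /andP[_ M1] := Mx v.
  have /andP[+ _] := Mx (x + (-1)%:C%C *: v).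
  move=> /(le_trans (mulr_ge0 (ltW c0) (dotr_ge0 _))).
  rewrite mulmxDr -scalemxAr !(dotrDr, dotrDl, dotrZr, dotrZl) -/v.
  have -> : dotr x (M *m v) = dotr v v by rewrite dotr_mull hM.
  rewrite /m; move: (dotr x v) (dotr v v) (dotr v (M *m v)) M1; clear => a b d.
  lra.
have xv : \sum_(i | p i == j)
    (Re (x i 0) * Re (v i 0) + Im (x i 0) * Im (v i 0)) = m.
  rewrite /m dotrE [RHS](bigID (fun i => p i == j))/= [X in _ + X]big1 ?addr0//.
  by move=> i /xj ->; rewrite /= !mul0r addr0.
have xx : \sum_(i | p i == j) (Re (x i 0) ^+ 2 + Im (x i 0) ^+ 2) = dotr x x.
  rewrite sqE [RHS](bigID (fun i => p i == j))/= [X in _ + X]big1 ?addr0//.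
  by move=> i /xj ->; rewrite /= expr0n addr0.
set K := (1 + delta) / rho; have K0 : 0 < K by rewrite divr_gt0//; lra.
set S := \sum_(i | _) (Re (v i 0) ^+ 2 + _) in psd'.
have SK : S <= K * m.
  rewrite /K mulrAC ler_pdivlMr// mulrC; apply: le_trans psd' _.
  by rewrite mulrDl mul1r lerD2l ler_wpM2l.
(* Cauchy-Schwarz on the block: expanding [|K x - v|^2] and using [S <= K * m] gives
   [m <= K * dotr x x]. *)
have : 0 <= \sum_(i | p i == j) ((K * Re (x i 0) - Re (v i 0)) ^+ 2 +
    (K * Im (x i 0) - Im (v i 0)) ^+ 2).
  by apply: sumr_ge0 => i _; rewrite addr_ge0 ?sqr_ge0.
have -> : \sum_(i | p i == j) ((K * Re (x i 0) - Re (v i 0)) ^+ 2 +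
    (K * Im (x i 0) - Im (v i 0)) ^+ 2) = K ^+ 2 * dotr x x - 2 * K * m + S.
  rewrite -xx -xv /S !mulr_sumr -sumrB -big_split /=.
  by apply: eq_bigr => i _; ring.
rewrite -/m => h; rewrite -(ler_pM2l K0); move: h SK.
rewrite expr2 -mulrA; lra.
Qed.

End HermitianPaving.

Lemma hermitian_paving (R : realType) (eps : R) : 0 < eps ->
  exists2 r : nat, (0 < r)%N & forall n (A : 'M[R[i]]_n),
    ctmx A = A -> (forall i, A i i = 0) ->
    (forall x : 'cV_n, - dotr x x <= dotr x (A *m x) <= dotr x x) ->
    exists p : 'I_n -> 'I_r, forall j (x : 'cV_n),
      (forall i, p i != j -> x i 0 = 0) ->
      dotr x (A *m x) <= eps * dotr x x.
Proof.
move=> eps0; pose e := eps / 4.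
have e0 : 0 < e by rewrite /e; lra.
(* Chosen so that [1 - rho / 2 = delta] and [(1 + delta) / rho = 1/2 + e]. *)
pose rho := 2 / (1 + e); pose delta := e / (1 + e).
have e1 : 0 < 1 + e by lra.
have rho0 : 0 < rho by rewrite divr_gt0.
have d0 : 0 < delta by rewrite divr_gt0.
have rho2E : 1 - rho / 2 = delta by rewrite /rho /delta; field; rewrite gt_eqF.
have rho2 : rho / 2 < 1 by rewrite -subr_gt0 rho2E.
(* The barrier condition becomes [r >= rho / delta ^+ 2], independent of the matrix and its size. *)
pose r := (Num.bound (rho / (delta * delta))).+1.
have rP : rho / r%:R <= delta * (1 - rho / 2).
  have dd0 : 0 < delta * delta by rewrite mulr_gt0.
  rewrite rho2E ler_pdivrMr ?ltr0n// mulrC -ler_pdivrMr//.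
  apply: (le_trans (ltW (archi_boundP _))); first by rewrite divr_ge0 ?ltW.
  by rewrite ler_nat.
exists r => // n A hA A0 Ax.
pose M : 'M[R[i]]_n := (2^-1)%:C%C%:M + (4^-1)%:C%C *: A.
have Mdot (x : 'cV_n) : dotr x (M *m x) = 2^-1 * dotr x x + 4^-1 * dotr x (A *m x).
  by rewrite mulmxDl mul_scalar_mx -scalemxAl dotrDr !dotrZr.
have [||||p hp] :=
  @block_bound _ n r M rho delta 4^-1 _ _ _ _ isT rho0 (ltW d0) rho2 rP.
- by rewrite ctmxD ctmx_scalar ctmxZ hA.
- by move=> i; rewrite !mxE eqxx mulr1n A0 mulr0 addr0.
- by rewrite invr_gt0.
- by move=> x; rewrite Mdot; have := Ax x; have := dotr_ge0 x; lra.
exists p => j x /hp; rewrite Mdot.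
have -> : (1 + delta) / rho = 2^-1 + eps / 4.
  by rewrite /rho /delta /e; field; rewrite !gt_eqF//; lra.
lra.
Qed.

(** * From quadratic forms to the operator norm *)

Section NumericalRadius.
Variable R : rcfType.
Local Notation C := R[i].

Definition hermpart n (A : 'M[C]_n) : 'M[C]_n := (2^-1)%:C%C *: (A + ctmx A).

Lemma ctmx_hermpart n (A : 'M[C]_n) : ctmx (hermpart A) = hermpart A.
Proof. by rewrite /hermpart ctmxZ ctmxD ctmxK addrC. Qed.

Lemma dotr_hermpart n (A : 'M[C]_n) (x : 'cV[C]_n) :
  dotr x (hermpart A *m x) = dotr x (A *m x).
Proof.
rewrite /hermpart -scalemxAl dotrZr mulmxDl dotrDr.
by rewrite [dotr x (ctmx A *m x)]dotr_mull ctmxK [dotr (_ *m _) _]dotrC; lra.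
Qed.

Lemma dotr_i n (x y : 'cV[C]_n) : dotr ('i%C *: x) ('i%C *: y) = dotr x y.
Proof.
rewrite !dotrE; apply: eq_bigr => i _; rewrite !mxE.
by case: (x i 0) => a b; case: (y i 0) => c d /=; ring.
Qed.

(** Polarization: the forms at [x + t y] and [x - t y], with [y = H *m x], differ by [4 t |y|^2];
    then [t = c^-1], or [t = 1] when [c = 0]. *)
Lemma hermitian_bound n (H : 'M[C]_n) c : ctmx H = H -> 0 <= c ->
  (forall x, `|dotr x (H *m x)| <= c * dotr x x) ->
  forall x, dotr (H *m x) (H *m x) <= c ^+ 2 * dotr x x.
Proof.
move=> hH c0 Hc x; set y := H *m x.
have polar (t : R) : 4 * t * dotr y y <= c * (2 * dotr x x + 2 * t ^+ 2 * dotr y y).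
  have Hy : dotr x (H *m y) = dotr y y by rewrite dotr_mull hH.
  have quad (s : R) : `|dotr x y + s * (2 * dotr y y + s * dotr y (H *m y))| <=
      c * (dotr x x + s * (2 * dotr x y + s * dotr y y)).
    have := Hc (x + s%:C%C *: y).
    rewrite mulmxDr -/y -scalemxAr !dotrDl !dotrDr !dotrZl !dotrZr Hy (dotrC y x).
    by congr (`|_| <= _ * _); ring.
  have := quad t; have := quad (- t).
  rewrite !ler_norml => /andP[+ _] /andP[_ +].
  move: (dotr x x) (dotr y y) (dotr x y) (dotr y _) => a b d e; lra.
have [c00|c_neq0] := eqVneq c 0.
  by have := polar 1; rewrite c00; lra.
have c_gt0 : 0 < c by rewrite lt_neqAle eq_sym c_neq0.
have := polar c^-1; rewrite -(ler_pM2l c_gt0).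
have -> : c * (4 / c * dotr y y) = 4 * dotr y y by field; rewrite gt_eqF.
have -> : c * (c * (2 * dotr x x + 2 * c^-1 ^+ 2 * dotr y y)) =
  2 * (c ^+ 2 * dotr x x) + 2 * dotr y y by field; rewrite gt_eqF.
lra.
Qed.

(** [A] is [H - i K] with [H] and [K] the hermitian parts of [A] and [i A], each of norm at most
    [c]; the sum costs the factor 2. *)
Lemma numerical_radius_bound n (A : 'M[C]_n) c : 0 <= c ->
  (forall x, `|dotr x (A *m x)| <= c * dotr x x) ->
  (forall x, `|dotr x (('i%C *: A) *m x)| <= c * dotr x x) ->
  forall x, dotr (A *m x) (A *m x) <= (2 * c) ^+ 2 * dotr x x.
Proof.
move=> c0 A1 A2 x.
have H1 y : `|dotr y (hermpart A *m y)| <= c * dotr y y by rewrite dotr_hermpart.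
have H2 y : `|dotr y (hermpart ('i%C *: A) *m y)| <= c * dotr y y.
  by rewrite dotr_hermpart.
have := hermitian_bound (ctmx_hermpart _) c0 H1 x.
have := hermitian_bound (ctmx_hermpart _) c0 H2 x.
set u := hermpart A *m x; set v := hermpart ('i%C *: A) *m x.
rewrite -(dotr_i v v).
have AE : A = hermpart A + (-1)%:C%C *: ('i%C *: hermpart ('i%C *: A)).
  apply/matrixP => i j; rewrite !mxE.
  case: (A i j) => a b; case: (A j i) => a' b'.
  by apply/eqP; rewrite eq_complex /=; apply/andP; split; apply/eqP; field.
have -> : A *m x = u + (-1)%:C%C *: ('i%C *: v).
  by rewrite {1}AE mulmxDl -(scalemxAl (-1)%:C%C) -(scalemxAl 'i%C).
move: ('i%C *: v) => w wx ux.
have := dotr_ge0 (u + w); rewrite !(dotrDl, dotrDr, dotrZl, dotrZr) [dotr w u]dotrC.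
lra.
Qed.

End NumericalRadius.

(** * Two-sided paving of quadratic forms, and the operator norm *)

Section FormPaving.
Variable R : realType.
Local Notation C := R[i].

(** Hermitian paving bounds a form from above only, so it is used for [T], [- T], [i T] and [- i T];
    the common refinement has [r ^ 4] colours. *)
Lemma form_paving (eps : R) : 0 < eps ->
  exists2 r : nat, (0 < r)%N & forall n (T : 'M[C]_n) (N : R),
    (forall i, T i i = 0) -> 0 <= N ->
    (forall x : 'cV_n, dotr (T *m x) (T *m x) <= N ^+ 2 * dotr x x) ->
    exists p : 'I_n -> 'I_r, forall j (x : 'cV_n),
      (forall i, p i != j -> x i 0 = 0) ->
      `|dotr x (T *m x)| <= eps * N * dotr x x /\
      `|dotr x (('i%C *: T) *m x)| <= eps * N * dotr x x.
Proof.
move=> eps0; have [r r0 rP] := hermitian_paving eps0.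
pose P := ('I_r * 'I_r * ('I_r * 'I_r))%type.
have P0 : (0 < #|{: P}|)%N by rewrite !card_prod !card_ord !muln_gt0 r0.
exists #|{: P}| => // n T N T0 N0 TN.
have [N00|N_neq0] := eqVneq N 0.
  exists (fun=> Ordinal P0) => j x _.
  have Tx : T *m x = 0.
    apply/eqP; apply: contraT => /dotr_gt0; have := TN x.
    by rewrite N00 expr0n mul0r; lra.
  by rewrite -scalemxAl Tx scaler0 dotr0r normr0 N00 mulr0 mul0r.
have N_gt0 : 0 < N by rewrite lt_neqAle eq_sym N_neq0.
have side (S : 'M[C]_n) (s : R) : (forall i, S i i = 0) -> s ^+ 2 = 1 ->
    (forall x : 'cV_n, dotr (S *m x) (S *m x) <= N ^+ 2 * dotr x x) ->
    exists p : 'I_n -> 'I_r, forall j (x : 'cV_n),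
      (forall i, p i != j -> x i 0 = 0) -> s * dotr x (S *m x) <= eps * N * dotr x x.
  move=> S0 s2 SN.
  have Sdot x : dotr x (((s / N)%:C%C *: hermpart S) *m x) = s / N * dotr x (S *m x).
    by rewrite -scalemxAl dotrZr dotr_hermpart.
  have [|||p hp] := rP n ((s / N)%:C%C *: hermpart S).
  - by rewrite ctmxZ ctmx_hermpart.
  - by move=> i; rewrite !mxE S0 conjc0 addr0 !mulr0.
  - move=> x; rewrite Sdot -ler_norml !normrM.
    have -> : `|s| = 1.
      by apply/eqP; rewrite -sqrp_eq1// -normrX s2 normr1.
    rewrite mul1r gtr0_norm ?invr_gt0// mulrC ler_pdivrMr// mulrC.
    rewrite ler_norml; apply/andP.
    (* Cauchy-Schwarz: the squared norms of [N x + S x] and [N x - S x] bound the form of [S] by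
       [N * dotr x x]. *)
    have h1 := dotr_ge0 (N%:C%C *: x + S *m x).
    have h2 := dotr_ge0 (N%:C%C *: x + (-1)%:C%C *: (S *m x)).
    rewrite !(dotrDl, dotrDr, dotrZl, dotrZr) [dotr (S *m x) x]dotrC in h1 h2.
    have h3 := SN x; rewrite expr2 in h3.
    split; rewrite -(ler_pM2l N_gt0); move: h1 h2 h3; clear.
      by move: (dotr x x) (dotr x _) (dotr _ _) => a b d; lra.
    by move: (dotr x x) (dotr x _) (dotr _ _) => a b d; lra.
  exists p => j x /hp; rewrite Sdot mulrAC ler_pdivrMr//; lra.
have TNi (x : 'cV_n) :
    dotr (('i%C *: T) *m x) (('i%C *: T) *m x) <= N ^+ 2 * dotr x x.
  by rewrite -scalemxAl dotr_i.
have Ti0 i : ('i%C *: T) i i = 0 by rewrite mxE T0 mulr0.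
have s1 : 1 ^+ 2 = 1 :> R by rewrite expr1n.
have s2 : (-1) ^+ 2 = 1 :> R by rewrite sqrrN expr1n.
have [p1 h1] := side T 1 T0 s1 TN.
have [p2 h2] := side T (-1) T0 s2 TN.
have [p3 h3] := side ('i%C *: T) 1 Ti0 s1 TNi.
have [p4 h4] := side ('i%C *: T) (-1) Ti0 s2 TNi.
exists (fun i => enum_rank ((p1 i, p2 i), (p3 i, p4 i))) => j x xj.
case jE : (enum_val j) => [[j1 j2] [j3 j4]].
have xP i : (p1 i, p2 i, (p3 i, p4 i)) != (j1, j2, (j3, j4)) -> x i 0 = 0.
  by move=> ne; apply: xj; apply: contra ne => /eqP pj; rewrite -jE -pj enum_rankK.
have {}h1 : 1 * dotr x (T *m x) <= eps * N * dotr x x.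
  by apply: (h1 j1) => i ne; apply: xP; rewrite !xpair_eqE (negbTE ne).
have {}h2 : -1 * dotr x (T *m x) <= eps * N * dotr x x.
  by apply: (h2 j2) => i ne; apply: xP; rewrite !xpair_eqE (negbTE ne) andbF.
have {}h3 : 1 * dotr x (('i%C *: T) *m x) <= eps * N * dotr x x.
  by apply: (h3 j3) => i ne; apply: xP; rewrite !xpair_eqE (negbTE ne) andbF.
have {}h4 : -1 * dotr x (('i%C *: T) *m x) <= eps * N * dotr x x.
  by apply: (h4 j4) => i ne; apply: xP; rewrite !xpair_eqE (negbTE ne) !andbF.
rewrite !ler_norml; move: h1 h2 h3 h4; clear.
move: (dotr x (T *m x)) (dotr x (('i%C *: T) *m x)) (eps * N * dotr x x) => a b d.
by move=> *; split; apply/andP; split; lra.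
Qed.

Lemma l2normE n (x : 'cV[C]_n) : l2norm x = Num.sqrt (dotr x x).
Proof.
rewrite /l2norm dotrE; congr Num.sqrt; apply: eq_bigr => i _.
by case: (x i 0) => a b /=; rewrite sqr_sqrtr ?addr_ge0 ?sqr_ge0// !expr2.
Qed.

Lemma opnorm_ge0 n (T : 'M[C]_n) : 0 <= opnorm T.
Proof.
have T0 : l2norm (T *m 0) = 0 by rewrite l2normE mulmx0 dotr0r sqrtr0.
rewrite -T0; apply: sup_upper_bound (opnorm_has_sup T) _ _.
exists 0 => //=; rewrite l2normE dotr0r sqrtr0; exact: ler01.
Qed.

Lemma opnormP n (T : 'M[C]_n) (x : 'cV_n) :
  dotr (T *m x) (T *m x) <= opnorm T ^+ 2 * dotr x x.
Proof.
have [->|x0] := eqVneq x 0; first by rewrite mulmx0 !dotr0r mulr0.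
have d0 := dotr_gt0 x0.
pose s := Num.sqrt (dotr x x); have s0 : 0 < s by rewrite sqrtr_gt0.
have ss : s ^+ 2 = dotr x x by rewrite sqr_sqrtr// ltW.
have : l2norm (T *m ((s^-1)%:C%C *: x)) <= opnorm T.
  apply: sup_upper_bound (opnorm_has_sup T) _ _; exists ((s^-1)%:C%C *: x) => //=.
  rewrite l2normE dotrZl dotrZr -ss mulrA expr2.
  by rewrite (_ : _ * _ = 1) ?sqrtr1//; field; rewrite gt_eqF.
rewrite l2normE -scalemxAr dotrZl dotrZr => h.
have : s^-1 * (s^-1 * dotr (T *m x) (T *m x)) <= opnorm T ^+ 2.
  rewrite -[leLHS]sqr_sqrtr; last by rewrite !mulr_ge0 ?dotr_ge0// invr_ge0 ltW.
  by rewrite lerXn2r ?nnegrE ?sqrtr_ge0 ?opnorm_ge0.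
by rewrite mulrA -invfM -expr2 ss ler_pdivrMl// mulrC.
Qed.

Lemma opnorm_le n (T : 'M[C]_n) c : 0 <= c ->
  (forall x : 'cV_n, dotr (T *m x) (T *m x) <= c ^+ 2 * dotr x x) ->
  opnorm T <= c.
Proof.
move=> c0 Tc; apply: ge_sup; first by have [] := opnorm_has_sup T.
move=> _ [x /= + <-]; rewrite !l2normE => x1.
have cx : dotr (T *m x) (T *m x) <= c ^+ 2.
  apply: le_trans (Tc x) _; rewrite ler_piMr ?exprn_ge0//.
  by rewrite -[leLHS]sqr_sqrtr ?dotr_ge0// expr_le1 ?sqrtr_ge0.
by rewrite -[leRHS](ger0_norm c0) -sqrtr_sqr ler_wsqrtr.
Qed.

End FormPaving.

(** * Paving by diagonal projections *)

Theorem theorem8p2 :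
  forall (R : realType) (eps : R), 0 < eps ->
  exists r : nat, (0 < r)%N /\
  forall (m : nat) (T : 'M[R[i]]_m), (0 < m)%N -> diag_part T = 0 ->
  exists Q : 'I_r -> 'M[R[i]]_m,
    [/\ forall j : 'I_r, is_diag_proj (Q j),
        \sum_(j < r) Q j = 1%:M &
        forall j : 'I_r, opnorm (Q j *m T *m Q j) <= eps * opnorm T].
Proof.
move=> R eps eps0.
(* Half of [eps], as [numerical_radius_bound] loses a factor 2. *)
have e0 : 0 < eps / 2 by rewrite divr_gt0.
have [r r0 rP] := form_paving e0; exists r; split=> // m T _ diagT.
have T0 i : T i i = 0.
  by move/matrixP: diagT => /(_ i i); rewrite !mxE eqxx mulr1n.
have N0 := opnorm_ge0 T.
have [p hp] := rP m T (opnorm T) T0 N0 (opnormP T).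
pose Q j : 'M[R[i]]_m := diag_mx (\row_i (p i == j)%:R).
have ctQ j : ctmx (Q j) = Q j.
  apply/matrixP => i k; rewrite !mxE [i == k]eq_sym; case: (k =P i) => [->|_].
    by rewrite !mulr1n; exact: conjc_nat.
  by rewrite !mulr0n; exact: conjc0.
have Qx j (x : 'cV[R[i]]_m) i : (Q j *m x) i 0 = (p i == j)%:R * x i 0.
  by rewrite mul_diag_mx !mxE.
exists Q; split=> [j||j].
- split=> [|i]; first exact: diag_mx_is_diag.
  by rewrite !mxE eqxx mulr1n; case: (p i == j); [right|left].
- apply/matrixP => i k; rewrite summxE mxE (bigD1 (p i))//= big1 ?addr0.
    by rewrite !mxE eqxx.
  by move=> j ji; rewrite !mxE [p i == j]eq_sym (negbTE ji) mul0rn.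
have c0 : 0 <= eps / 2 * opnorm T by rewrite mulr_ge0// ltW.
have Qle (x : 'cV[R[i]]_m) : dotr (Q j *m x) (Q j *m x) <= dotr x x.
  rewrite !dotrE; apply: ler_sum => i _; rewrite Qx -!expr2.
  case: (p i == j); rewrite ?mul1r// mul0r /= expr0n addr0.
  by rewrite addr_ge0 ?sqr_ge0.
have supp (x : 'cV[R[i]]_m) i : p i != j -> (Q j *m x) i 0 = 0.
  by rewrite Qx => /negbTE ->; rewrite mul0r.
(* [Q j] is self-adjoint and contracting: the form of the compression at [x] is that of [S] at
   [Q j *m x], a vector supported on colour [j]. *)
have bound (S : 'M[R[i]]_m) (x : 'cV[R[i]]_m) :
    `|dotr (Q j *m x) (S *m (Q j *m x))| <=
      eps / 2 * opnorm T * dotr (Q j *m x) (Q j *m x) ->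
    `|dotr x ((Q j *m S *m Q j) *m x)| <= eps / 2 * opnorm T * dotr x x.
  move=> h; rewrite -!mulmxA dotr_mull ctQ; apply: le_trans h _.
  by rewrite ler_wpM2l.
apply: opnorm_le => [|x]; first by rewrite mulr_ge0// ltW.
have -> : eps * opnorm T = 2 * (eps / 2 * opnorm T) by field.
apply: numerical_radius_bound => // y.
  by apply: bound; have [] := hp j _ (supp y).
have -> : 'i%C *: (Q j *m T *m Q j) = Q j *m ('i%C *: T) *m Q j.
  by rewrite -scalemxAr -scalemxAl.
by apply: bound; have [] := hp j _ (supp y).
Qed.
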